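(* There exists an absolute constant $C>0$ such that the following holds for all integers $d\ge 1$, $s\in\{1,\dots,d\}$, all $\sigma>0$, every $\boldsymbol{\theta}\in B_0(s,d)$ and every covariance matrix $\boldsymbol{\Sigma}$ satisfying Assumption $(\varepsilon^*0)$: \[ \mathbf{E}_{\boldsymbol\theta,\boldsymbol\Sigma}[(\hat Q-\|\boldsymbol\theta\|_2^2)^2]\le C\left(\sigma^2\|\boldsymbol\theta\|_2^2\,\lambda_{\max}(\boldsymbol\Sigma_{\mathcal S,\mathcal S})+\sigma^4\psi^2(s,\boldsymbol\Sigma)\right), \] where $\mathcal S=\{i:\theta_i\neq 0\}$ is the support of $\boldsymbol\theta$. Furthermore, for every $r>0$ and every $\boldsymbol\Sigma$ satisfying Assumption $(\varepsilon^*0)$, \[ \sup_{\boldsymbol\theta\in B_0(s,d)\cap B_2(r)}\mathbf{E}_{\boldsymbol\theta,\boldsymbol\Sigma}[(\hat Q-\|\boldsymbol\theta\|_2^2)^2]\le C\left(\sigma^2 r^2\bar\psi(s,\boldsymbol\Sigma)+\sigma^4\psi^2(s,\boldsymbol\Sigma)\right) \] and \[ \sup_{\boldsymbol\theta\in B_0(s,d)}\mathbf{E}_{\boldsymbol\theta,\boldsymbol\Sigma}[(\hat N-\|\boldsymbol\theta\|_2)^2]\le C\sigma^2\psi(s,\boldsymbol\Sigma). \]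
   Context: Model: one observes $\boldsymbol Y=(Y_1,\dots,Y_d)=\boldsymbol\theta+\sigma\boldsymbol\varepsilon$, where $\boldsymbol\theta\in\mathbb R^d$ is unknown, $\boldsymbol\varepsilon\sim\mathcal N(\boldsymbol 0,\boldsymbol\Sigma)$ with $\boldsymbol\Sigma$ a $d\times d$ covariance matrix, and the noise level $\sigma>0$ is known. $\mathbf P_{\boldsymbol\theta,\boldsymbol\Sigma}$, $\mathbf E_{\boldsymbol\theta,\boldsymbol\Sigma}$ denote probability and expectation under this model. The diagonal entries $\sigma_i^2=\boldsymbol\Sigma_{ii}$ are known; the off-diagonal entries are not used. $B_0(s,d)=\{\boldsymbol\theta\in\mathbb R^d:\|\boldsymbol\theta\|_0\le s\}$ ($\|\cdot\|_0$ = number of nonzero entries), $B_2(r)=\{x\in\mathbb R^d:\|x\|_2\le r\}$. Assumption $(\varepsilon^*0)$: $\max_{1\le i\le d}\sigma_i^2\le 1$. $\|\boldsymbol\Sigma\|_F$ is the Frobenius norm, $\lambda_{\max}$ the largest eigenvalue, $\boldsymbol\Sigma_{\mathcal S,\mathcal S}$ the principal submatrix with rows and columns in $\mathcal S$. Let $\tau=3\sqrt{\log(1+\|\boldsymbol\Sigma\|_F^2/s^2)}$ and $\beta_s=\mathbf E[Z^2\mid |Z|\ge\tau]$ for $Z\sim\mathcal N(0,1)$. The estimator is \[ \hat Q=\begin{cases}\sum_{i=1}^d(Y_i^2-\sigma^2\sigma_i^2\beta_s)\mathbb 1\{|Y_i|>\sigma\sigma_i\tau\}, & s\le\|\boldsymbol\Sigma\|_F,\\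 \sum_{i=1}^d(Y_i^2-\sigma^2\sigma_i^2), &\text{otherwise},\end{cases}\qquad \hat N=\sqrt{|\hat Q|}. \] Rates: $\psi(s,\boldsymbol\Sigma)=s\log(1+\|\boldsymbol\Sigma\|_F^2/s^2)$ if $s\le\|\boldsymbol\Sigma\|_F$ and $\psi(s,\boldsymbol\Sigma)=\|\boldsymbol\Sigma\|_F$ otherwise; $\bar\psi(s,\boldsymbol\Sigma)=\lambda_{\max}(\boldsymbol\Sigma)\wedge s$. *)

(* Defs.v *)
From HB Require Import structures.
From mathcomp Require Import all_boot all_order all_algebra.
From mathcomp Require Import all_classical all_reals all_analysis.
Set Implicit Arguments. Unset Strict Implicit. Unset Printing Implicit Defensive.
Import Order.TTheory GRing.Theory Num.Theory.
Import numFieldNormedType.Exports.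
Local Open Scope classical_set_scope.
Local Open Scope ring_scope.

Section Defs.
Variable R : realType.

(* E[f(Z_0,...,Z_{n-1})] for Z_0,...,Z_{n-1} iid N(0,1), as the iterated
   Lebesgue integral against the standard normal law (coordinates >= n are
   frozen at 0 and are never used). *)
Fixpoint iter_gauss (n : nat) (f : (nat -> R) -> \bar R) (z : nat -> R) : \bar R :=
  match n with
  | 0 => f z
  | n'.+1 => (\int[normal_prob (0:R) 1]_x
                iter_gauss n' f (fun k => if k == n' then x else z k))%E
  end.

Definition gauss_expect (n : nat) (f : (nat -> R) -> \bar R) : \bar R :=
  iter_gauss n f (fun _ => 0).

(* Observation Y = theta + sigma * A z, so that eps = A z ~ N(0, A A^T). *)
Definition Yobs d (theta : 'I_d -> R) (sigma : R) (A : 'M[R]_d) (z : nat -> R)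
  : 'I_d -> R := fun i => theta i + sigma * \sum_(j < d) A i j * z j.

Definition covariance_mx d (Sig : 'M[R]_d) : Prop :=
  Sig^T = Sig /\ forall v : 'rV[R]_d, 0 <= (v *m Sig *m v^T) ord0 ord0.

Definition frob d (Sig : 'M[R]_d) : R :=
  Num.sqrt (\sum_(i < d) \sum_(j < d) Sig i j ^+ 2).

Definition lambda_max n (M : 'M[R]_n) : R := sup [set a | eigenvalue M a].

Definition theta_supp d (theta : 'I_d -> R) : {set 'I_d} := [set i | theta i != 0].

Definition principal_submx d (Sig : 'M[R]_d) (S : {set 'I_d}) : 'M[R]_#|S| :=
  \matrix_(i, j) Sig (enum_val i) (enum_val j).

Definition in_B0 d (s : nat) (theta : 'I_d -> R) : Prop := (#|theta_supp theta| <= s)%N.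

Definition sqnorm d (theta : 'I_d -> R) : R := \sum_(i < d) theta i ^+ 2.

Definition in_B2 d (r : R) (theta : 'I_d -> R) : Prop := Num.sqrt (sqnorm theta) <= r.

Definition tau d (s : nat) (Sig : 'M[R]_d) : R :=
  3 * Num.sqrt (ln (1 + frob Sig ^+ 2 / s%:R ^+ 2)).

(* beta_s = E[Z^2 | |Z| >= tau], Z ~ N(0,1) *)
Definition beta (t : R) : R :=
  fine (\int[normal_prob (0:R) 1]_(x in [set x : R | (t <= `|x|)%R]) (x ^+ 2)%:E)%E
  / fine (normal_prob (0:R) 1 [set x : R | t <= `|x|]).

Definition Qhat d (s : nat) (sigma : R) (Sig : 'M[R]_d) (Y : 'I_d -> R) : R :=
  if s%:R <= frob Sig then
    \sum_(i < d) (Y i ^+ 2 - sigma ^+ 2 * Sig i i * beta (tau s Sig))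
                 * (if sigma * Num.sqrt (Sig i i) * tau s Sig < `|Y i| then 1 else 0)
  else \sum_(i < d) (Y i ^+ 2 - sigma ^+ 2 * Sig i i).

Definition Nhat d (s : nat) (sigma : R) (Sig : 'M[R]_d) (Y : 'I_d -> R) : R :=
  Num.sqrt `|Qhat s sigma Sig Y|.

Definition psi d (s : nat) (Sig : 'M[R]_d) : R :=
  if s%:R <= frob Sig then s%:R * ln (1 + frob Sig ^+ 2 / s%:R ^+ 2)
  else frob Sig.

Definition psibar d (s : nat) (Sig : 'M[R]_d) : R := Num.min (lambda_max Sig) s%:R.

End Defs.

(* Main.v *)
Require Import Defs.
From HB Require Import structures.
From mathcomp Require Import all_boot all_order all_algebra.
From mathcomp Require Import all_classical all_reals all_analysis.
From mathcomp Require Import measurable_realfun.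
From mathcomp Require Import ring lra.
Set Implicit Arguments. Unset Strict Implicit. Unset Printing Implicit Defensive.
Import Order.TTheory GRing.Theory Num.Theory.
Import numFieldNormedType.Exports.
Local Open Scope classical_set_scope.
Local Open Scope ring_scope.


(** Write [Y i = theta i + sigma * eps i] with [eps = A z]. If [frob Sig < s], the error of [Qhat]
    is exactly [2 sigma <theta, eps> + sigma^2 sum_i (eps i ^ 2 - Sig i i)]. If [s <= frob Sig], it
    is the same linear term, plus [sigma^2] times a sum of [Sig i i * threshold_fun] over the
    coordinates off the support, plus a remainder carried by the at most [s] coordinates of the
    support ([sparse_devE]). That remainder is at most [sigma^2 (eps i ^ 2 + tau^2 + beta)] per
    coordinate, however large [theta i] is ([remainder_sqr_le]). The linear term has variance
    [4 sigma^2 theta^T Sig theta] ([signal_var]), and the various right-hand sides come from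
    bounding this quadratic form by a largest eigenvalue, by [s], or by the Frobenius norm.

    The heart is the variance of the remaining sum. Its terms are values [g(eps i / sd i)] of one
    even, centred function; [beta] is exactly the constant that centres the thresholded square.
    Expand the joint density of two standard Gaussians in their correlation [rho] (Mehler kernel):
    order 0 integrates to zero because [g] is centred, order 1 because [x * g x] is odd. Hence
    covariances are [O(rho^2)], with a further factor [exp(- tau^2 / 8)] because [g] vanishes below
    [tau] ([pair_cov_small], [pair_cov_large]). Summed over pairs, the variance is at most a
    constant times [exp(- tau^2 / 8) * frob^2], and [tau] is large enough to make this at most a
    constant times [s^2] ([tail_const_le]).

    Expectations are iterated integrals of nonnegative functions, and for the risk itself only
    monotonicity and superadditivity are used, which hold for arbitrary nonnegative integrands.
    [expect_le_quadratic] turns a pointwise bound into a bound in expectation by this route; it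
    needs exact values only for functions of two linear forms in [z], which rotation invariance
    reduces to planar integrals ([iter_gauss_planar]).

    For [Nhat], the squared error is at most both [|Q - b|] and [(Q - b)^2 / b], with [b] the
    squared norm of [theta]; the first is used when [b <= sigma^2 psi], the second otherwise
    ([norm_risk]). *)

(** * One-dimensional Gaussian integrals and changes of variables *)

Section Gaussian.
Variable R : realType.
Local Notation gam := (normal_prob (0:R) 1).
Local Notation mu := (@lebesgue_measure R).
Local Notation phi := (normal_pdf (0:R) 1).

Lemma normal_pdf01E (x : R) : phi x = normal_peak 1 * expR (- x ^+ 2 / 2).
Proof.
by rewrite normal_pdfE ?oner_neq0// /normal_fun subr0 expr1n mulr2n.
Qed.

Lemma normal_pdf01_gt0 (x : R) : 0 < phi x.
Proof. by rewrite normal_pdf01E mulr_gt0 ?expR_gt0 ?normal_peak_gt0. Qed.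

Lemma measurable_phiE (D : set R) : measurable_fun D (EFin \o phi).
Proof.
apply/measurable_EFinP/measurable_funTS; exact: measurable_normal_pdf.
Qed.

(** The explicit density and the Radon-Nikodym derivative have the same integral over every
    measurable set, so they agree almost everywhere. *)
Lemma integral_gauss (f : R -> \bar R) : measurable_fun setT f ->
  (forall x, 0 <= f x)%E ->
  (\int[gam]_x f x = \int[mu]_x (f x * (phi x)%:E))%E.
Proof.
move=> mf f0.
have dom := @normal_prob_dominates R 0 1.
rewrite -(@Radon_Nikodym_SigmaFinite.change_of_variables _ _ _ gam mu dom f setT)//.
have If := @Radon_Nikodym_SigmaFinite.f_integrable _ _ _ gam mu dom.
apply: ae_eq_integral => //.
- by apply: emeasurable_funM => //; exact: measurable_int If.
- by apply: emeasurable_funM => //; exact: measurable_phiE.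
- apply: ae_eqe_mul2l; apply: integral_ae_eq => //=.
  + exact: measurable_phiE.
  + by move=> A AT mA; rewrite -(Radon_Nikodym_SigmaFinite.f_integral dom).
Qed.

(** [r] times the push-forward of Lebesgue measure by [x -> r x + m] agrees with Lebesgue measure on
    half-open intervals, hence everywhere by uniqueness. *)
Lemma ge0_integral_affine (r m : R) (f : R -> \bar R) : 0 < r ->
  measurable_fun setT f -> (forall x, 0 <= f x)%E ->
  (r%:E * \int[mu]_x f (r * x + m)%R = \int[mu]_x f x)%E.
Proof.
move=> r0 mf f0.
pose h : measurableTypeR R -> measurableTypeR R := fun x => r * x + m.
have mh : measurable_fun setT h.
  by apply: measurable_funD => //; apply: measurable_funM.
pose nu : {measure set (measurableTypeR R) -> \bar R} := mscale (NngNum (ltW r0)) (measure_function_pushforward__canonical__measure_function_Measure mu mh).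
rewrite -[RHS](@eq_measure_integral _ _ _ _ mu nu); last first.
  move=> A mA _; apply/esym; apply: lebesgue_measure_unique => //= _ [[a b]] _ <-.
  rewrite /nu /mscale/= /pushforward.
  have -> : h @^-1` `]a, b] = `](a - m) / r, (b - m) / r]%classic.
    apply/seteqP; split => x /=; rewrite !in_itv/= /h.
      by rewrite ltr_pdivrMr// ler_pdivlMr// ltrBlDr lerBrDr mulrC.
    by rewrite ltr_pdivrMr// ler_pdivlMr// ltrBlDr lerBrDr (mulrC x).
  rewrite !lebesgue_measure_itv/= !lte_fin.
  rewrite ltr_pM2r ?invr_gt0// ltrD2r.
  case: ifPn => ab; last by rewrite mule0.
  rewrite -!EFinD -EFinM; congr EFin; field; exact: lt0r_neq0.
rewrite ge0_integral_mscale//; congr (_ * _)%E.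
by rewrite ge0_integral_pushforward.
Qed.

Lemma gauss_integralN (f : R -> \bar R) :
  measurable_fun setT f -> (forall x, 0 <= f x)%E ->
  (\int[gam]_x f (- x)%R = \int[gam]_x f x)%E.
Proof.
move=> mf f0; rewrite !integral_gauss//; last first.
  by apply: measurableT_comp => //; exact: oppr_measurable.
transitivity (\int[pushforward mu (-%R : _ -> measurableTypeR R)]_x (f x * (phi x)%:E))%E; last first.
  by apply: eq_measure_integral => A mA _; exact: lebesgue_measureN.
rewrite ge0_integral_pushforward//=.
- by apply: eq_integral => x _; rewrite !normal_pdf01E sqrrN.
- by apply: emeasurable_funM => //; exact: measurable_phiE.
- by move=> x _; rewrite mule_ge0// lee_fin normal_pdf_ge0.
Qed.

End Gaussian.


Lemma measurable_phi_comp (R : realType) d (T : measurableType d) (D : set T)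
    (f : T -> R) : measurable_fun D f ->
  measurable_fun D (fun x => normal_pdf (0:R) 1 (f x)).
Proof. by move=> mf; apply: measurableT_comp mf; exact: measurable_normal_pdf. Qed.

Lemma measurable_expR_comp (R : realType) d (T : measurableType d) (D : set T)
    (f : T -> R) : measurable_fun D f -> measurable_fun D (fun x => expR (f x)).
Proof. by move=> mf; apply: measurableT_comp mf; exact: measurable_expR. Qed.

(** Recursion on the syntax of the function. The clause for differences precedes the one for sums,
    since a difference is a sum with an opposite. *)
Ltac meas := lazymatch goal with
  | |- measurable_fun _ (fun _ => ?c) => exact: measurable_cst
  | |- measurable_fun _ (fun x => x) => exact: measurable_id
  | |- measurable_fun _ (fun x => fst x) => exact: measurable_fst
  | |- measurable_fun _ (fun x => snd x) => exact: measurable_snd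
  | |- measurable_fun _ (fun x => fst (fst x)) =>
      exact: (measurableT_comp measurable_fst measurable_fst)
  | |- measurable_fun _ (fun x => snd (fst x)) =>
      exact: (measurableT_comp measurable_snd measurable_fst)
  | |- measurable_fun _ (fun x => (@?f x, @?g x)) =>
      apply: measurable_fun_pair => /=; meas
  | |- measurable_fun _ (fun x => GRing.add (@?f x) (GRing.opp (@?g x))) =>
      apply: measurable_funB => /=; meas
  | |- measurable_fun _ (fun x => GRing.add (@?f x) (@?g x)) =>
      first [apply: measurable_funD => /= | apply: emeasurable_funD => /=]; meas
  | |- measurable_fun _ (fun x => GRing.opp (@?f x)) =>
      apply: measurableT_comp => /=; [exact: oppr_measurable|meas]
  | |- measurable_fun _ (fun x => GRing.mul (@?f x) (@?g x)) =>
      apply: measurable_funM => /=; meas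
  | |- measurable_fun _ (fun x => GRing.exp (@?f x) _) =>
      apply: measurable_funX => /=; meas
  | |- measurable_fun _ (fun x => normal_pdf _ _ (@?f x)) =>
      apply: measurable_phi_comp => /=; meas
  | |- measurable_fun _ (fun x => expR (@?f x)) =>
      apply: measurable_expR_comp => /=; meas
  | |- measurable_fun _ (fun x => (@?f x)%:E) =>
      apply/measurable_EFinP => /=; meas
  | |- measurable_fun _ (fun x => (@?f x * @?g x)%E) =>
      apply: emeasurable_funM => /=; meas
  | |- measurable_fun _ (fun x => (@?f x + @?g x)%E) =>
      apply: emeasurable_funD => /=; meas
  | |- _ => try assumption
  end.

(** * Rotation invariance of the standard planar Gaussian *)

Section Rotation.
Variable R : realType.
Local Notation gam := (normal_prob (0:R) 1).
Local Notation mu := (@lebesgue_measure R).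
Local Notation phi := (normal_pdf (0:R) 1).

Lemma gauss_integral_affine (r m : R) (f : R -> \bar R) : 0 < r ->
  measurable_fun setT f -> (forall x, 0 <= f x)%E ->
  (\int[gam]_x f (r * x + m)%R
   = \int[mu]_u (f u * (r^-1 * phi ((u - m) / r))%:E))%E.
Proof.
move=> r0 mf f0; have rn0 : r != 0 by exact: lt0r_neq0.
rewrite integral_gauss//; last first.
  by apply: (measurableT_comp mf); meas.
rewrite -(@ge0_integral_affine R r m (fun u => f u * (r^-1 * phi ((u - m) / r))%:E)%E)//.
- rewrite -ge0_integralZl//=; last 3 first.
  + apply: emeasurable_funM; first by apply: (measurableT_comp mf); meas.
    by meas.
  + by move=> x _; rewrite mule_ge0// lee_fin mulr_ge0 ?normal_pdf_ge0// invr_ge0 ltW.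
  + by rewrite lee_fin ltW.
  apply: eq_integral => x _.
  rewrite addrK (mulrC r) mulfK// muleCA -EFinM; congr (_ * _%:E)%E.
  by rewrite mulrA divff// mul1r.
- apply: emeasurable_funM => //.
  by meas.
- by move=> x; rewrite mule_ge0// lee_fin mulr_ge0 ?normal_pdf_ge0// invr_ge0 ltW.
Qed.

Lemma normal_pdf01_rot (c s u v : R) : c ^+ 2 + s ^+ 2 = 1 ->
  phi (c * u - s * v) * phi (c * v + s * u) = phi u * phi v.
Proof.
move=> cs; rewrite !normal_pdf01E.
rewrite mulrACA [RHS]mulrACA -!expRD; congr (_ * expR _).
have -> : - (c * u - s * v) ^+ 2 / 2 + - (c * v + s * u) ^+ 2 / 2 =
  (c ^+ 2 + s ^+ 2) * (- u ^+ 2 / 2 + - v ^+ 2 / 2) by field.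
by rewrite cs mul1r.
Qed.

(** Two one-dimensional substitutions with Tonelli in between: for fixed [x] take [u = s x + c t] as
    variable, then for fixed [u] take [v] with [x = c v + s u]. Both divide by [c]. The product of
    densities that results is rotation invariant ([normal_pdf01_rot]). *)
Lemma gauss_rotation_pos (c s : R) (H : R * R -> \bar R) : 0 < c ->
  c ^+ 2 + s ^+ 2 = 1 -> measurable_fun setT H -> (forall p, 0 <= H p)%E ->
  (\int[gam]_x \int[gam]_t H (c * x - s * t, s * x + c * t)%R
   = \int[gam]_x \int[gam]_t H (x, t))%E.
Proof.
move=> c0 cs mH H0; have cn0 : c != 0 by exact: lt0r_neq0.
pose G (p : R * R) : \bar R := (H (((p.1 - s * p.2) / c)%R, p.2)
   * (c^-1 * phi ((p.2 - s * p.1) / c) * phi p.1)%:E)%E.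
have mG : measurable_fun setT G.
  apply: emeasurable_funM; first by apply: (measurableT_comp mH); meas.
  by meas.
have G0 p : (0 <= G p)%E.
  rewrite /G mule_ge0// lee_fin !mulr_ge0 ?normal_pdf_ge0//.
  by rewrite invr_ge0 ltW.
have inner x : (\int[gam]_t H (c * x - s * t, s * x + c * t)%R
    = \int[mu]_u (H (((x - s * u) / c)%R, u) * (c^-1 * phi ((u - s * x) / c))%:E))%E.
  rewrite -(@gauss_integral_affine c (s * x) (fun u => H (((x - s * u) / c)%R, u)))//.
    apply: eq_integral => t _; congr (H (_, _)); last by rewrite addrC.
    apply: (mulIf cn0); rewrite divfK//.
    apply/eqP; rewrite -subr_eq0; apply/eqP.
    transitivity ((c ^+ 2 + s ^+ 2 - 1) * x); first by ring.
    by rewrite cs subrr mul0r.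
  by apply: (measurableT_comp mH); meas.
transitivity (\int[mu]_x \int[mu]_u G (x, u))%E.
  under eq_integral do rewrite inner.
  rewrite integral_gauss.
  - apply: eq_integral => x _; rewrite -ge0_integralZr//.
    + by apply: eq_integral => u _; rewrite /G/= -muleA -EFinM.
    + apply: emeasurable_funM; first by apply: (measurableT_comp mH); meas.
      by meas.
    + move=> u _; rewrite mule_ge0// lee_fin mulr_ge0 ?normal_pdf_ge0//.
      by rewrite invr_ge0 ltW.
    + by rewrite lee_fin normal_pdf_ge0.
  - apply: (@measurable_fun_fubini_tonelli_F _ _ _ _ _ mu (fun p : R * R =>
      (H (((p.1 - s * p.2) / c)%R, p.2) * (c^-1 * phi ((p.2 - s * p.1) / c))%:E)%E)).
    + apply: emeasurable_funM; first by apply: (measurableT_comp mH); meas.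
      by meas.
    + move=> p; rewrite mule_ge0// lee_fin mulr_ge0 ?normal_pdf_ge0//.
      by rewrite invr_ge0 ltW.
  - move=> x; apply: integral_ge0 => u _.
    rewrite mule_ge0// lee_fin mulr_ge0 ?normal_pdf_ge0//.
    by rewrite invr_ge0 ltW.
rewrite (@fubini_tonelli _ _ _ _ _ mu mu G)//.
rewrite -[RHS](@fubini_tonelli _ _ _ _ _ gam gam (fun p => H (p.2, p.1)))//; last first.
  by apply: (measurableT_comp mH); meas.
rewrite [RHS]integral_gauss; first last.
- by move=> x; apply: integral_ge0.
- apply: (@measurable_fun_fubini_tonelli_F _ _ _ _ _ gam (fun p : R * R => H (p.2, p.1))) => //.
  by apply: (measurableT_comp mH); meas.
apply: eq_integral => u _ /=.
rewrite integral_gauss//; last by apply: (measurableT_comp mH); meas.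
rewrite -ge0_integralZr//; first last.
- by rewrite lee_fin normal_pdf_ge0.
- by move=> v _; rewrite mule_ge0// lee_fin normal_pdf_ge0.
- apply: emeasurable_funM; first by apply: (measurableT_comp mH); meas.
  exact: measurable_phiE.
rewrite -(@ge0_integral_affine R c (s * u) (fun x => G (x, u)))//; last first.
  by apply: (measurableT_comp mG); meas.
rewrite -ge0_integralZl//; first last.
- by rewrite lee_fin ltW.
- by apply: (measurableT_comp mG); meas.
apply: eq_integral => v _; rewrite /G/= addrK [(c * v)%R]mulrC mulfK//.
have -> : (u - s * (v * c + s * u)) / c = c * u - s * v.
  apply: (mulIf cn0); rewrite divfK//.
  apply/eqP; rewrite -subr_eq0; apply/eqP.
  transitivity ((1 - (c ^+ 2 + s ^+ 2)) * u); first by ring.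
  by rewrite cs subrr mul0r.
rewrite muleCA -EFinM -muleA -EFinM; congr (_ * _%:E)%E.
rewrite mulrA mulrA divff// mul1r (mulrC v) normal_pdf01_rot//.
by rewrite mulrC.
Qed.

(** For [c = 0] the rotation is a quarter turn ([s = 1] or [s = -1]): a swap of coordinates followed
    by one reflection. *)
Lemma gauss_rotation (c s : R) (H : R * R -> \bar R) : 0 <= c ->
  c ^+ 2 + s ^+ 2 = 1 -> measurable_fun setT H -> (forall p, 0 <= H p)%E ->
  (\int[gam]_x \int[gam]_t H (c * x - s * t, s * x + c * t)%R
   = \int[gam]_x \int[gam]_t H (x, t))%E.
Proof.
move=> + cs mH H0; rewrite le0r => /orP[/eqP c0|c0]; last exact: gauss_rotation_pos.
have ss : s ^+ 2 = 1 by move: cs; rewrite c0 expr0n add0r.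
rewrite (@fubini_tonelli _ _ _ _ _ gam gam (fun p : R * R => H (c * p.1 - s * p.2, s * p.1 + c * p.2)%R))//=; last first.
  by apply: (measurableT_comp mH); meas.
have mH1 (a : R) : measurable_fun setT (fun t => H (a, t)).
  by apply: (measurableT_comp mH); meas.
have mH2 : measurable_fun setT (fun x => \int[gam]_t H (x, t))%E.
  exact: (@measurable_fun_fubini_tonelli_F _ _ _ _ _ gam H).
have H20 x : (0 <= \int[gam]_t H (x, t))%E by apply: integral_ge0.
have /orP[/eqP s1|/eqP s1] : (s == 1) || (s == -1) by rewrite -eqf_sqr ss expr1n.
- rewrite -[RHS]gauss_integralN//; apply: eq_integral => t _.
  by apply: eq_integral => x _; rewrite c0 s1; congr (H (_, _)); ring.
- apply: eq_integral => t _; rewrite -[RHS]gauss_integralN//.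
  by apply: eq_integral => x _; rewrite c0 s1; congr (H (_, _)); ring.
Qed.

End Rotation.


(** * Iterated Gaussian integrals and their reduction to the plane *)

Section IteratedGauss.
Variable R : realType.
Local Notation gam := (normal_prob (0:R) 1).

(** The integral of a nonnegative function is a supremum over the simple functions below it, so it
    is monotone even for non-measurable integrands. *)
Lemma integral_le_nneg d (T : measurableType d) (m : {measure set T -> \bar R})
  (f g : T -> \bar R) : (forall x, 0 <= f x)%E -> (forall x, f x <= g x)%E ->
  (\int[m]_x f x <= \int[m]_x g x)%E.
Proof.
move=> f0 fg; rewrite !ge0_integralTE//; last first.
  by move=> x; exact: le_trans (f0 x) (fg x).
apply: le_ereal_sup => _ [h hf <-]; exists h => // x.
exact: le_trans (hf x) (fg x).
Qed.

Lemma gauss_integral_cst (k : \bar R) : (\int[gam]_x k = k)%E.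
Proof. by rewrite (integral_cst _ measurableT) [X in (_ * X)%E]probability_setT mule1. Qed.

Import HBNNSimple.

(** Simple functions below [f] and below [g] add up to one below [f + g]. Without measurability only
    this direction is available; it suffices to subtract a known expectation from an upper bound. *)
Lemma integral_superadd_nneg d (T : measurableType d) (m : {measure set T -> \bar R})
  (f g : T -> \bar R) : (forall x, 0 <= f x)%E -> (forall x, 0 <= g x)%E ->
  (\int[m]_x f x + \int[m]_x g x <= \int[m]_x (f x + g x))%E.
Proof.
move=> f0 g0.
have [->|] := eqVneq (\int[m]_x (f x + g x))%E +oo%E; first exact: leey.
rewrite -ltey => fin.
have finf : (\int[m]_x f x)%E \is a fin_num.
  rewrite ge0_fin_numE ?integral_ge0//; apply: le_lt_trans fin.
  by apply: integral_le_nneg => // x; rewrite leeDl.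
have fing : (\int[m]_x g x)%E \is a fin_num.
  rewrite ge0_fin_numE ?integral_ge0//; apply: le_lt_trans fin.
  by apply: integral_le_nneg => // x; rewrite leeDr.
have sub (k : T -> \bar R) (h : {nnsfun T >-> R}) : (forall x, 0 <= k x)%E ->
    (forall x, (h x)%:E <= k x)%E -> (sintegral m h <= \int[m]_x k x)%E.
  by move=> k0 hk; rewrite ge0_integralTE//; apply: ereal_sup_ubound; exists h.
rewrite -leeBrDr// {1}ge0_integralTE//.
apply: ge_ereal_sup => _ [h hf <-].
have finh : sintegral m h \is a fin_num.
  rewrite ge0_fin_numE ?sintegral_ge0//.
  apply: le_lt_trans (sub _ _ f0 hf) _; by rewrite ltey_eq finf.
rewrite leeBrDr// addeC -leeBrDr// {1}ge0_integralTE//.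
apply: ge_ereal_sup => _ [h' hg <-].
rewrite leeBrDr// addeC -sintegralD.
apply: (sub _ (h \+ h')%R) => x; first exact: adde_ge0.
by rewrite /= EFinD; apply: leeD; [exact: hf|exact: hg].
Qed.

Lemma iter_gauss_ge0 n (f : (nat -> R) -> \bar R) z :
  (forall w, 0 <= f w)%E -> (0 <= iter_gauss n f z)%E.
Proof.
by move=> f0; elim: n z => [|n IH] z //=; apply: integral_ge0 => x _.
Qed.

Lemma le_iter_gauss n (f g : (nat -> R) -> \bar R) z :
  (forall w, 0 <= f w)%E -> (forall w, f w <= g w)%E ->
  (iter_gauss n f z <= iter_gauss n g z)%E.
Proof.
move=> f0 fg; elim: n z => [|n IH] z //=.
by apply: integral_le_nneg => x; [exact: iter_gauss_ge0|exact: IH].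
Qed.

Lemma iter_gauss_superadd n (f g : (nat -> R) -> \bar R) z :
  (forall w, 0 <= f w)%E -> (forall w, 0 <= g w)%E ->
  (iter_gauss n f z + iter_gauss n g z <= iter_gauss n (fun w => f w + g w) z)%E.
Proof.
move=> f0 g0; elim: n z => [|n IH] z //=.
apply: le_trans (integral_superadd_nneg _ _ _) _; [move=> x; exact: iter_gauss_ge0..|].
by apply: integral_le_nneg => x; [apply: adde_ge0; exact: iter_gauss_ge0|exact: IH].
Qed.

Lemma eq_iter_gauss n (f g : (nat -> R) -> \bar R) z :
  (forall w, (forall k, (n <= k)%N -> w k = z k) -> f w = g w) ->
  iter_gauss n f z = iter_gauss n g z.
Proof.
elim: n z => [|n IH] z fg /=; first exact: fg.
apply: eq_integral => x _; apply: IH => w wz; apply: fg => k nk.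
by rewrite wz ?(ltnW nk)// gtn_eqF.
Qed.

(* Coordinates of a planar Gaussian vector with covariance
   [[p^2, p q], [p q, q^2 + r^2]] in terms of two independent N(0,1). *)
Definition planar_law (p q r : R) (h : R * R -> \bar R) : \bar R :=
  (\int[gam]_x \int[gam]_y h (p * x, q * x + r * y)%R)%E.

(** The triple [((p, q), r)] is a Cholesky factor of the Gram matrix of [a] and [b] restricted to
    their first [n] coordinates. *)
Definition planar_coef n (a b : nat -> R) (c : R * R * R) :=
  [/\ 0 <= c.1.1 /\ 0 <= c.2, c.1.1 ^+ 2 = \sum_(j < n) a j ^+ 2,
     c.1.1 * c.1.2 = \sum_(j < n) a j * b j &
     c.1.2 ^+ 2 + c.2 ^+ 2 = \sum_(j < n) b j ^+ 2].

(** Polar coordinates of [(p, al)]; at the origin the angle is taken to be zero. *)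
Lemma hypot_coef (p al : R) : 0 <= p -> exists k c s : R,
  [/\ 0 <= k, 0 <= c, c ^+ 2 + s ^+ 2 = 1, p = k * c & al = k * s].
Proof.
move=> p0; set k := Num.sqrt (p ^+ 2 + al ^+ 2).
have k2 : k ^+ 2 = p ^+ 2 + al ^+ 2 by rewrite sqr_sqrtr// addr_ge0// sqr_ge0.
have [k0|k0] := eqVneq k 0.
  have : p ^+ 2 + al ^+ 2 == 0 by rewrite -k2 k0 expr0n.
  rewrite paddr_eq0 ?sqr_ge0// !sqrf_eq0 => /andP[/eqP-> /eqP->].
  by exists 0, 1, 0; split => //; rewrite ?ler01// ?mul0r// expr1n expr0n addr0.
exists k, (p / k), (al / k); split.
- exact: sqrtr_ge0.
- by rewrite divr_ge0// sqrtr_ge0.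
- by rewrite !exprMn -mulrDl -k2 exprVn divff// expf_neq0.
- by rewrite mulrCA divff// mulr1.
- by rewrite mulrCA divff// mulr1.
Qed.

Lemma planar_law_ge0 p q r h : (forall u, 0 <= h u)%E -> (0 <= planar_law p q r h)%E.
Proof.
by move=> h0; apply: integral_ge0 => x _; apply: integral_ge0.
Qed.

Lemma measurable_planar_shift p q r (al be : R) h : measurable_fun setT h ->
  (forall u, 0 <= h u)%E ->
  measurable_fun setT (fun w : R * R =>
    \int[gam]_y h (p * w.1 + al * w.2, q * w.1 + r * y + be * w.2)%R)%E.
Proof.
move=> mh h0; apply: (@measurable_fun_fubini_tonelli_F _ _ _ _ _ gam
  (fun v : (R * R) * R => h (p * v.1.1 + al * v.1.2, q * v.1.1 + r * v.2 + be * v.1.2)%R)) => //.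
by apply: (measurableT_comp mh); meas.
Qed.

(* Adding an independent coordinate: one rotation removes it from the first
   component, a second one merges it into the fresh noise of the second. *)
Lemma planar_coefS n (a b : nat -> R) c : planar_coef n a b c ->
  exists c', planar_coef n.+1 a b c' /\
    forall h, measurable_fun setT h -> (forall u, 0 <= h u)%E ->
    (\int[gam]_t planar_law c.1.1 c.1.2 c.2 (fun u => h (u.1 + a n * t, u.2 + b n * t)%R)
     = planar_law c'.1.1 c'.1.2 c'.2 h)%E.
Proof.
case: c => [[p q] r] [/= [p0 r0] pa pqab qrb].
have [p' [c [s [p'0 c0 cs pE alE]]]] := hypot_coef (a n) p0.
(* Coefficient of [t] in the second component after the first rotation: [q (c x - s t) + r y + b n
   (s x + c t) = (q c + b n s) x + r y + w t]. *)
pose w := b n * c - q * s.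
have [r' [c1 [s1 [r'0 c10 cs1 rE wE]]]] := hypot_coef w r0.
exists (p', q * c + b n * s, r'); split.
  split => //=; rewrite big_ord_recr/=.
  - by rewrite -pa alE pE !exprMn -mulrDr cs mulr1.
  - by rewrite -pqab alE pE; ring.
  - rewrite -qrb rE.
    have -> : r' ^+ 2 = (r' * c1) ^+ 2 + w ^+ 2.
      by rewrite wE !exprMn -mulrDr cs1 mulr1.
    have -> : (q * c + b n * s) ^+ 2 + ((r' * c1) ^+ 2 + w ^+ 2) =
      (r' * c1) ^+ 2 + (q ^+ 2 + b n ^+ 2) * (c ^+ 2 + s ^+ 2) by rewrite /w; ring.
    by rewrite cs; ring.
move=> h mh h0; rewrite /planar_law/=.
pose H (v : R * R) := (\int[gam]_y h (p * v.1 + a n * v.2, q * v.1 + r * y + b n * v.2)%R)%E.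
have mH : measurable_fun setT H by exact: measurable_planar_shift.
have H0 v : (0 <= H v)%E by apply: integral_ge0.
transitivity (\int[gam]_x \int[gam]_t H (x, t))%E.
  by rewrite (@fubini_tonelli _ _ _ _ _ gam gam H).
rewrite -(gauss_rotation c0 cs)//; apply: eq_integral => x _.
pose K (v : R * R) := h (p' * x, (q * c + b n * s) * x + (r * v.1 + w * v.2))%R.
have mK : measurable_fun setT K by apply: (measurableT_comp mh); meas.
transitivity (\int[gam]_t \int[gam]_y K (y, t))%E.
  apply: eq_integral => t _; apply: eq_integral => y _; congr (h (_, _)) => /=.
    rewrite pE alE.
    have -> : p' * c * (c * x - s * t) + p' * s * (s * x + c * t) =
      (c ^+ 2 + s ^+ 2) * (p' * x) by ring.
    by rewrite cs mul1r.
  by rewrite /w; ring.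
rewrite -(@fubini_tonelli _ _ _ _ _ gam gam K)//; last by move=> v; exact: h0.
rewrite -(gauss_rotation c10 cs1)//; last by move=> v; exact: h0.
apply: eq_integral => y _.
transitivity (\int[gam]_t h (p' * x, (q * c + b n * s) * x + r' * y)%R)%E.
  apply: eq_integral => t _; congr (h (_, _ + _)) => /=.
  have -> : r' * y = r' * (c1 ^+ 2 + s1 ^+ 2) * y by rewrite cs1 mulr1.
  by rewrite rE wE; ring.
exact: gauss_integral_cst.
Qed.

Lemma measurable_planar_law_shift p q r (al be : R) h : measurable_fun setT h ->
  (forall u, 0 <= h u)%E ->
  measurable_fun setT (fun t => planar_law p q r (fun u => h (u.1 + al * t, u.2 + be * t)%R)).
Proof.
move=> mh h0.
apply: (@measurable_fun_fubini_tonelli_F _ _ _ _ _ gam (fun w : R * R =>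
  \int[gam]_y h (p * w.2 + al * w.1, q * w.2 + r * y + be * w.1)%R)%E).
  apply: (@measurable_fun_fubini_tonelli_F _ _ _ _ _ gam (fun v : (R * R) * R =>
    h (p * v.1.2 + al * v.1.1, q * v.1.2 + r * v.2 + be * v.1.1)%R)) => //.
  by apply: (measurableT_comp mh); meas.
by move=> v; apply: integral_ge0.
Qed.

(** Induction on [n]: the outermost variable shifts both linear forms, and [planar_coefS] absorbs
    the shift. A whole finite family is treated at once because the sum must be moved through every
    integral, which the measurability of each shifted planar law allows. *)
Lemma iter_gauss_planar (K : finType) (a b : K -> nat -> R) n :
  exists c : K -> R * R * R, (forall k, planar_coef n (a k) (b k) (c k)) /\
  forall (h : K -> R * R -> \bar R) z,
    (forall k, measurable_fun setT (h k)) -> (forall k u, 0 <= h k u)%E ->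
    (iter_gauss n (fun w => \sum_k h k
        (\sum_(j < n) a k j * w j, \sum_(j < n) b k j * w j)%R) z
     = \sum_k planar_law (c k).1.1 (c k).1.2 (c k).2 (h k))%E.
Proof.
elim: n => [|n [c [Hc IH]]].
  exists (fun _ => (0, 0, 0)); split.
    by move=> k; split => //=; rewrite big_ord0 ?expr0n ?mul0r ?addr0//.
  move=> h z mh h0 /=; apply: eq_bigr => k _; rewrite !big_ord0 /planar_law.
  have E : (\int[gam]_x \int[gam]_y h k (0 * x, 0 * x + 0 * y)%R = \int[gam]_x \int[gam]_y h k (0, 0)%R)%E.
    by apply: eq_integral => x _; apply: eq_integral => y _; rewrite !mul0r addr0.
  by rewrite {}E !gauss_integral_cst.
have /choice[c' Hc'] : forall k, exists c', planar_coef n.+1 (a k) (b k) c' /\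
    forall h, measurable_fun setT h -> (forall u, 0 <= h u)%E ->
    (\int[gam]_t planar_law (c k).1.1 (c k).1.2 (c k).2 (fun u => h (u.1 + a k n * t, u.2 + b k n * t)%R)
     = planar_law c'.1.1 c'.1.2 c'.2 h)%E.
  by move=> k; exact: planar_coefS.
exists c'; split; first by move=> k; have [] := Hc' k.
move=> h z mh h0 /=.
transitivity (\int[gam]_t \sum_k planar_law (c k).1.1 (c k).1.2 (c k).2
   (fun u => h k (u.1 + a k n * t, u.2 + b k n * t)%R))%E.
  apply: eq_integral => t _.
  rewrite -(IH (fun k u => h k (u.1 + a k n * t, u.2 + b k n * t)%R)
    (fun k => if k == n then t else z k))//; last first.
    by move=> k; apply: (measurableT_comp (mh k)); meas.
  apply: eq_iter_gauss => w wz; apply: eq_bigr => k _.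
  by rewrite !big_ord_recr/= (wz n)// eqxx.
rewrite ge0_integral_sum//.
- by apply: eq_bigr => k _; rewrite (proj2 (Hc' k)).
- by move=> k; exact: measurable_planar_law_shift.
- by move=> k t _; exact: planar_law_ge0.
Qed.

End IteratedGauss.


(** * Exponential bounds and Gaussian moments *)

Ltac nonneg := repeat first [ done | exact: sqr_ge0 | exact: expR_ge0
  | exact: addr_ge0 | apply: mulr_ge0 | apply: addr_ge0 ].
Ltac side := first [ by meas
  | by move=> ? _; rewrite -?EFinM -?EFinD lee_fin; nonneg
  | by rewrite lee_fin; nonneg ].

Section GaussMoments.
Variable R : realType.
Local Notation gam := (normal_prob (0:R) 1).
Local Notation mu := (@lebesgue_measure R).
Local Notation phi := (normal_pdf (0:R) 1).

Lemma le_expR (x : R) : x <= expR x.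
Proof. by apply: le_trans (expR_ge1Dx x); rewrite lerDr. Qed.

Lemma sqr_le_expR (x : R) : 0 <= x -> x ^+ 2 <= 4 * expR x.
Proof.
move=> x0; have := le_expR (x / 2) => h.
have -> : expR x = expR (x / 2) ^+ 2 by rewrite -expRM_natl; congr expR; field.
have -> : x ^+ 2 = 4 * (x / 2) ^+ 2 by field.
rewrite ler_pM2l//; apply: lerXn2r => //; rewrite nnegrE ?expR_ge0//.
exact: divr_ge0.
Qed.

Lemma expR_sub1_le (w : R) : `|expR w - 1| <= `|w| * expR `|w|.
Proof.
have h1 := expR_ge1Dx w; have h2 := expR_ge1Dx (- w).
have e1 : expR w * expR (- w) = 1 by rewrite -expRD subrr expR0.
have p1 := expR_gt0 w; have p2 := expR_gt0 (- w).
have [w0|w0] := leP 0 w.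
  rewrite !ger0_norm//; last lra.
  nra.
have -> : `|w| = - w by rewrite ltr0_norm.
rewrite ler0_norm; last by rewrite subr_le0 -expR0 ler_expR ltW.
have : 1 <= expR (- w) by rewrite -expR0 ler_expR; lra.
nra.
Qed.

Lemma expR_taylor2_le (w : R) : `|expR w - 1 - w| <= w ^+ 2 * expR `|w|.
Proof.
have h1 := expR_ge1Dx w; have h2 := expR_ge1Dx (- w).
have e1 : expR w * expR (- w) = 1 by rewrite -expRD subrr expR0.
have p1 := expR_gt0 w.
rewrite ger0_norm; last lra.
(* This is [1 - w <= expR (- w)] multiplied by [expR w]. *)
have A : expR w - 1 - w <= w * (expR w - 1) by nra.
apply: (le_trans A); apply: (le_trans (ler_norm _)); rewrite normrM.
have -> : w ^+ 2 = `|w| * `|w| by rewrite -expr2 real_normK ?num_real.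
by rewrite -mulrA; apply: ler_wpM2l => //; exact: expR_sub1_le.
Qed.

Lemma normal_peak1_ge : 1 / 3 <= normal_peak (1 : R).
Proof.
rewrite /normal_peak expr1n mul1r mul1r lef_pV2 ?posrE//; last first.
  by rewrite sqrtr_gt0 mulrn_wgt0// pi_gt0.
have -> : (3 : R) = Num.sqrt (3 ^+ 2) by rewrite sqrtr_sqr ger0_norm.
rewrite ler_sqrt; last by rewrite sqr_ge0.
have := pihalf_lt2 R; rewrite -mulr_natr; lra.
Qed.

(** Multiplied by the standard density, the integrand is [s] times the density of [N(0, s^2)]. *)
Lemma gauss_integral_expR_sqr (s : R) : 0 < s ->
  (\int[gam]_x (expR (x ^+ 2 / 2 * (1 - s ^- 2)))%:E = s%:E)%E.
Proof.
move=> s0; have sn0 : s != 0 by exact: lt0r_neq0.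
rewrite integral_gauss; first last.
- by move=> x; rewrite lee_fin expR_ge0.
- by meas.
transitivity (\int[mu]_x (s%:E * (normal_pdf 0 s x)%:E))%E; last first.
  by rewrite integralZl//; [rewrite integral_normal_pdf mule1|exact: integrable_normal_pdf].
apply: eq_integral => x _; rewrite -!EFinM; congr EFin.
rewrite (normal_pdfE _ sn0) normal_pdf01E /normal_fun subr0 mulrCA.
rewrite -expRD [RHS]mulrA; congr (_ * expR _); last first.
  by rewrite -exprVn; field.
rewrite /normal_peak expr1n mul1r -mulrnAr sqrtrM ?sqr_ge0// sqrtr_sqr gtr0_norm//.
by rewrite invfM mulrA divff// mul1r.
Qed.

Lemma gauss_integral_expR4E :
  (\int[gam]_x (expR (x ^+ 2 / 4))%:E = (Num.sqrt 2)%:E)%E.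
Proof.
have s2 : 0 < Num.sqrt (2 : R) by rewrite sqrtr_gt0.
rewrite -(gauss_integral_expR_sqr s2) sqr_sqrtr//.
by apply: eq_integral => x _; congr (expR _)%:E; field.
Qed.

Lemma sqrt2_le2 : Num.sqrt (2 : R) <= 2.
Proof.
rewrite -(@ler_pXn2r _ 2) ?nnegrE ?sqrtr_ge0// sqr_sqrtr//; lra.
Qed.

Lemma gauss_integral_expR4 : (\int[gam]_x (expR (x ^+ 2 / 4))%:E <= 2%:E)%E.
Proof. by rewrite gauss_integral_expR4E lee_fin; exact: sqrt2_le2. Qed.

(** [expR (x ^+ 2 / 4)] serves throughout as the dominating function; its Gaussian integral is
    [sqrt 2]. *)
Lemma gauss_integrable_le_expR4 (f : R -> R) (C : R) : measurable_fun setT f ->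
  (forall x, `|f x| <= C * expR (x ^+ 2 / 4)) ->
  gam.-integrable setT (EFin \o f).
Proof.
move=> mf fC; apply: (@le_integrable _ _ _ gam setT measurableT _
  (fun x => (C%:E * (expR (x ^+ 2 / 4))%:E)%E)).
- exact/measurable_EFinP.
- move=> x _; rewrite /= lee_fin; apply: le_trans (fC x) _; exact: ler_norm.
- apply: integrableZl => //; apply/integrableP; split; first by meas.
  apply: (@le_lt_trans _ _ 2%:E); last exact: ltry.
  apply: le_trans gauss_integral_expR4.
  by apply: integral_le_nneg => x//; rewrite /= ger0_norm ?expR_ge0.
Qed.

Lemma gauss_integral_le_expR4 (f : R -> R) (C : R) : (forall x, 0 <= f x) ->
  (forall x, f x <= C * expR (x ^+ 2 / 4)) -> 0 <= C ->
  (\int[gam]_x (f x)%:E <= (2 * C)%:E)%E.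
Proof.
move=> f0 fC C0.
apply: (@le_trans _ _ (\int[gam]_x (C%:E * (expR (x ^+ 2 / 4))%:E))%E).
  by apply: integral_le_nneg => x; rewrite -?EFinM lee_fin.
rewrite ge0_integralZl//; [|side..].
rewrite mulrC EFinM; apply: lee_wpmul2l; first by rewrite lee_fin.
exact: gauss_integral_expR4.
Qed.

Lemma gauss_integral_odd (f : R -> R) : gam.-integrable setT (EFin \o f) ->
  (forall x, f (- x) = - f x) -> (\int[gam]_x (f x)%:E = 0)%E.
Proof.
move=> intf fN; have mf := measurable_int _ intf.
rewrite integralE.
have E : (\int[gam]_x ((EFin \o f)^\- (- x)%R) = \int[gam]_x ((EFin \o f)^\+ x))%E.
  by apply: eq_integral => x _; rewrite funenegE funeposE /= fN opprK.
rewrite gauss_integralN// in E; last exact: measurable_funeneg.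
rewrite [X in (_ - X)%E]E subee//.
exact: integrable_pos_fin_num.
Qed.

(** Let [m] be the second moment. For [t = (1 - s^-2) / 2] the integral of [expR (t x^2)] is [s],
    while Taylor expansion puts it between [1 + t m] and [1 + t m + O(t^2)]. With [s = 1 + e] and
    [e] tending to 0 this forces [m = 1]. *)
Lemma gauss_integral_sqr : (\int[gam]_x (x ^+ 2)%:E = 1%:E)%E.
Proof.
have m0 : (0 <= \int[gam]_x (x ^+ 2)%:E)%E.
  by apply: integral_ge0 => x _; rewrite lee_fin sqr_ge0.
have mfin : (\int[gam]_x (x ^+ 2)%:E)%E \is a fin_num.
  rewrite ge0_fin_numE//; apply: le_lt_trans (ltry (2 * 4)).
  apply: gauss_integral_le_expR4 => // x; first exact: sqr_ge0.
  by have := le_expR (x ^+ 2 / 4); lra.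
have [m mE] : exists m : R, (\int[gam]_x (x ^+ 2)%:E)%E = m%:E.
  by exists (fine (\int[gam]_x (x ^+ 2)%:E)%E); rewrite fineK.
rewrite mE in m0 *; rewrite lee_fin in m0.
have lin (t C : R) : 0 <= t -> 0 <= C ->
  (\int[gam]_x (1 + t * x ^+ 2 + C * expR (x ^+ 2 / 4))%:E = (1 + t * m + C * Num.sqrt 2)%:E)%E.
  move=> t0 C0; rewrite !EFinD !EFinM -mE.
  rewrite (_ : (\int[gam]_x _)%E = (\int[gam]_x (1%:E + t%:E * (x ^+ 2)%:E + C%:E * (expR (x ^+ 2 / 4))%:E))%E); last first.
    by apply: eq_integral => x _; rewrite !EFinD !EFinM.
  rewrite ge0_integralD//; [|side..].
  rewrite ge0_integralD//; [|side..].
  rewrite gauss_integral_cst ge0_integralZl//; [|side..].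
  rewrite ge0_integralZl//; [|side..].
  by rewrite gauss_integral_expR4E.
have bounds (e : R) : 0 < e -> e <= 1 / 16 ->
    m * (2 + e) <= 2 * (1 + e) ^+ 2 /\ 2 <= m * (2 + e) + 2400 * e.
  move=> e0 e8; pose s := 1 + e; pose t := (1 - s ^- 2) / 2.
  have s1 : 1 <= s by rewrite /s; lra.
  have s0 : 0 < s by rewrite /s; lra.
  have tE : t * (2 * s ^+ 2) = e * (2 + e).
    rewrite /t mulrA divfK// mulrBl mul1r mulVf; last by rewrite expf_neq0// lt0r_neq0.
    by rewrite /s; ring.
  have t0 : 0 <= t.
    rewrite /t; apply: divr_ge0 => //; rewrite subr_ge0 invf_le1 ?exprn_gt0//.
    by rewrite exprn_ege1.
  have s2 : 1 <= s ^+ 2 by rewrite exprn_ege1.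
  have t2 : t * 2 <= e * (2 + e).
    by rewrite -tE; apply: ler_wpM2l => //; lra.
  have e2 : e * (2 + e) <= e * (33 / 16) by apply: ler_wpM2l; lra.
  have t8 : t <= 1 / 8 by lra.
  have te : t <= 2 * e by lra.
  have IE : (\int[gam]_x (expR (t * x ^+ 2))%:E = s%:E)%E.
    rewrite -(gauss_integral_expR_sqr s0); apply: eq_integral => x _.
    by rewrite /t; congr (expR _)%:E; ring.
  have lo : 1 + t * m <= s.
    have := lin t 0 t0 (lexx _); rewrite mul0r addr0 -lee_fin -IE => <-.
    apply: integral_le_nneg => x; rewrite lee_fin mul0r addr0.
      by rewrite addr_ge0// mulr_ge0// sqr_ge0.
    exact: expR_ge1Dx.
  have hi : s <= 1 + t * m + (256 * t ^+ 2) * Num.sqrt 2.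
    have t20 : 0 <= 256 * t ^+ 2 by rewrite mulr_ge0// sqr_ge0.
    rewrite -lee_fin -(lin t _ t0 t20) -IE.
    apply: integral_le_nneg => x; rewrite lee_fin ?expR_ge0//.
    have x20 := sqr_ge0 x.
    have := expR_taylor2_le (t * x ^+ 2).
    rewrite (@ger0_norm _ (t * _)); last by apply: mulr_ge0.
    move/(le_trans (ler_norm _)).
    (* With [y = x^2 / 8] the left side is at most [64 t^2 y^2 expR y], and [y^2 <= 4 expR y] gives
       [256 = 64 * 4]. *)
    have : (t * x ^+ 2) ^+ 2 * expR (t * x ^+ 2) <= 256 * t ^+ 2 * expR (x ^+ 2 / 4).
      have h1 : expR (t * x ^+ 2) <= expR (x ^+ 2 / 8) by rewrite ler_expR; nra.
      have h2 : (x ^+ 2 / 8) ^+ 2 <= 4 * expR (x ^+ 2 / 8) by apply: sqr_le_expR; lra.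
      have -> : expR (x ^+ 2 / 4) = expR (x ^+ 2 / 8) * expR (x ^+ 2 / 8).
        by rewrite -expRD; congr expR; field.
      have -> : (t * x ^+ 2) ^+ 2 = 64 * t ^+ 2 * (x ^+ 2 / 8) ^+ 2 by field.
      have p8 := expR_ge0 (x ^+ 2 / 8).
      apply: (@le_trans _ _ (64 * t ^+ 2 * (x ^+ 2 / 8) ^+ 2 * expR (x ^+ 2 / 8))).
        by apply: ler_wpM2l => //; nonneg.
      rewrite [leRHS]mulrA; apply: ler_wpM2r => //.
      have -> : 256 * t ^+ 2 * expR (x ^+ 2 / 8) = 64 * t ^+ 2 * (4 * expR (x ^+ 2 / 8)) by ring.
      by apply: ler_wpM2l => //; rewrite mulr_ge0// sqr_ge0.
    lra.
  have q2 := sqrt2_le2; have q0 := sqrtr_ge0 (2 : R).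
  split.
    have h : (e - t * m) * (2 * s ^+ 2) >= 0.
      by apply: mulr_ge0; [rewrite /s in lo; lra|rewrite mulr_ge0// sqr_ge0].
    have -> : (1 + e) = s by [].
    have : e * (m * (2 + e)) <= e * (2 * s ^+ 2).
      have -> : e * (m * (2 + e)) = m * (t * (2 * s ^+ 2)) by rewrite tE; ring.
      lra.
    by rewrite ler_pM2l.
  have h1 : e <= t * m + 512 * t ^+ 2.
    have : 256 * t ^+ 2 * Num.sqrt 2 <= 256 * t ^+ 2 * 2.
      by apply: ler_wpM2l => //; rewrite mulr_ge0// sqr_ge0.
    rewrite /s in hi; lra.
  have h2 : e * (2 * s ^+ 2) <= e * (2 + e) * m + 512 * t * (e * (2 + e)).
    have : e * (2 * s ^+ 2) <= (t * m + 512 * t ^+ 2) * (2 * s ^+ 2).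
      by apply: ler_wpM2r => //; rewrite mulr_ge0// sqr_ge0.
    have -> : (t * m + 512 * t ^+ 2) * (2 * s ^+ 2) = (t * (2 * s ^+ 2)) * m + 512 * t * (t * (2 * s ^+ 2)) by ring.
    by rewrite tE.
  have h3 : 2 * s ^+ 2 <= (2 + e) * m + 512 * t * (2 + e).
    rewrite -(@ler_pM2l _ e)//.
    apply: (le_trans h2); rewrite le_eqVlt; apply/orP; left; apply/eqP; ring.
  have h4 : 512 * t * (2 + e) <= 512 * (2 * e) * (17 / 8).
    by apply: ler_pM; lra.
  lra.
have le1 : m <= 1.
  apply/ler_addgt0Pr => e e0.
  pose d := Num.min e (1 / 8).
  have d0 : 0 < d by rewrite lt_min e0/=; lra.
  have de : d <= e by rewrite ge_min lexx.
  have d8 : d <= 1 / 8 by rewrite ge_min lexx orbT.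
  have [h _] := bounds (d / 4) ltac:(lra) ltac:(lra).
  nra.
have ge1 : 1 <= m.
  apply/ler_addgt0Pr => e e0.
  pose d := Num.min e (1 / 8).
  have d0 : 0 < d by rewrite lt_min e0/=; lra.
  have de : d <= e by rewrite ge_min lexx.
  have d8 : d <= 1 / 8 by rewrite ge_min lexx orbT.
  have [_ h] := bounds (d / 2400) ltac:(lra) ltac:(lra).
  nra.
by congr EFin; apply/eqP; rewrite eq_le le1.
Qed.

End GaussMoments.


(** * The Mehler kernel and its first-order expansion *)

Section PairCovariance.
Variable R : realType.
Local Notation gam := (normal_prob (0:R) 1).
Local Notation mu := (@lebesgue_measure R).
Local Notation phi := (normal_pdf (0:R) 1).

(** Mehler's kernel: with [rho^2 + r^2 = 1], the density at [u], relative to [N(0,1)], of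
    [rho x + r y] for fixed [x] and standard Gaussian [y]. *)
Definition mehler (rho r x u : R) : R :=
  r^-1 * expR ((2 * rho * x * u - rho ^+ 2 * (x ^+ 2 + u ^+ 2)) / (2 * r ^+ 2)).

Lemma mehler_pdf (rho r x u : R) : 0 < r -> rho ^+ 2 + r ^+ 2 = 1 ->
  r^-1 * phi ((u - rho * x) / r) = mehler rho r x u * phi u.
Proof.
move=> r0 rr; have rn0 : r != 0 by exact: lt0r_neq0.
rewrite /mehler !normal_pdf01E -[RHS]mulrA; congr (_ * _).
rewrite [RHS]mulrCA -expRD; congr (_ * expR _).
have -> : rho ^+ 2 = 1 - r ^+ 2 by rewrite -rr; ring.
rewrite exprMn exprVn.
have -> : (u - rho * x) ^+ 2 = u ^+ 2 - 2 * rho * x * u + (1 - r ^+ 2) * x ^+ 2.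
  have -> : 1 - r ^+ 2 = rho ^+ 2 by rewrite -rr; ring.
  ring.
by field.
Qed.

Lemma mehler_ge0 (rho r x u : R) : 0 <= r -> 0 <= mehler rho r x u.
Proof. by move=> r0; rewrite mulr_ge0 ?expR_ge0// invr_ge0. Qed.

Lemma gauss_integral_mehler (rho r x : R) (f : R -> \bar R) : 0 < r ->
  rho ^+ 2 + r ^+ 2 = 1 -> measurable_fun setT f -> (forall u, 0 <= f u)%E ->
  (\int[gam]_y f (rho * x + r * y)%R
   = \int[gam]_u (f u * (mehler rho r x u)%:E))%E.
Proof.
move=> r0 rr mf f0.
transitivity (\int[gam]_y f (r * y + rho * x)%R)%E.
  by apply: eq_integral => y _; rewrite addrC.
rewrite gauss_integral_affine// integral_gauss; first last.
- by move=> u; rewrite mule_ge0// lee_fin mehler_ge0// ltW.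
- by rewrite /mehler; meas.
by apply: eq_integral => u _; rewrite mehler_pdf// EFinM muleA.
Qed.

Lemma mehler_approx (rho r x u : R) : `|rho| <= 1 / 64 -> 0 < r ->
  rho ^+ 2 + r ^+ 2 = 1 ->
  `|mehler rho r x u - 1 - rho * (x * u)|
    <= 130 ^+ 2 * rho ^+ 2 * (expR (x ^+ 2 / 16) * expR (u ^+ 2 / 16)).
Proof.
move=> rho64 r0 rr; have rn0 : r != 0 by exact: lt0r_neq0.
set a := `|rho| in rho64 *; have a0 : 0 <= a by exact: normr_ge0.
have rho2 : rho ^+ 2 = a ^+ 2 by rewrite /a real_normK ?num_real.
have a2 : a ^+ 2 <= a / 64.
  by rewrite expr2; apply: ler_wpM2l => //; lra.
have r2 : 1 / 2 <= r ^+ 2 by lra.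
have r21 : r ^+ 2 <= 1 by have := sqr_ge0 rho; lra.
have r1 : r <= 1 by rewrite -(@expr_le1 _ 2)// ltW.
pose q := (x ^+ 2 + u ^+ 2) / 2.
have q0 : 0 <= q by rewrite divr_ge0// addr_ge0 ?sqr_ge0.
pose iv := (r ^+ 2)^-1.
have ivE : iv * r ^+ 2 = 1 by rewrite mulVf// expf_neq0.
have iv2 : iv <= 2 by nra.
have iv1 : 1 <= iv by nra.
have iv10 : iv - 1 = a ^+ 2 * iv.
  by rewrite -rho2 -{1}ivE; have -> : rho ^+ 2 = 1 - r ^+ 2; [rewrite -rr|]; ring.
have xuq : `|x * u| <= q.
  have := sqr_ge0 (x - u); have := sqr_ge0 (x + u); rewrite ler_norml /q => h1 h2.
  apply/andP; split; nra.
pose w := iv * (rho * (x * u) - rho ^+ 2 * q).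
have mE : mehler rho r x u = r^-1 * expR w.
  by rewrite /mehler; congr (_ * expR _); rewrite /w /iv /q; field.
have rxu : `|rho * (x * u)| <= a * q by rewrite normrM; apply: ler_wpM2l.
have a2q : a ^+ 2 * q <= a * q.
  by apply: ler_wpM2r => //; lra.
have wB : `|w| <= 4 * a * q.
  rewrite /w normrM ger0_norm; last lra.
  have : `|rho * (x * u) - rho ^+ 2 * q| <= 2 * a * q.
    apply: (le_trans (ler_normB _ _)); rewrite rho2 [X in _ + X]ger0_norm; last by apply: mulr_ge0; rewrite ?sqr_ge0.
    lra.
  have := normr_ge0 (rho * (x * u) - rho ^+ 2 * q); nra.
have w1 : `|w - rho * (x * u)| <= 4 * a ^+ 2 * q.
  have -> : w - rho * (x * u) = (iv - 1) * (rho * (x * u)) - iv * (rho ^+ 2 * q).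
    by rewrite /w; ring.
  apply: (le_trans (ler_normB _ _)).
  rewrite iv10 rho2 normrM (ger0_norm (mulr_ge0 (sqr_ge0 a) _)); last lra.
  rewrite (ger0_norm (mulr_ge0 _ (mulr_ge0 (sqr_ge0 a) q0))); last lra.
  have h1 : a ^+ 2 * iv * `|rho * (x * u)| <= a ^+ 2 * 2 * q.
    have h2 : `|rho * (x * u)| <= q by nra.
    by apply: ler_pM => //; [nra|apply: ler_wpM2l => //; exact: sqr_ge0].
  have h3 : iv * (a ^+ 2 * q) <= 2 * (a ^+ 2 * q).
    by apply: ler_wpM2r => //; rewrite mulr_ge0 ?sqr_ge0.
  lra.
have rinv : `|r^-1 - 1| <= 2 * a ^+ 2.
  have ri : r^-1 * r = 1 by rewrite mulVf.
  have i1 : 1 <= r^-1 by rewrite invf_ge1.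
  rewrite ger0_norm; last lra.
  have : r^-1 <= iv by rewrite /iv -exprVn expr2; nra.
  have := ler_wpM2l (sqr_ge0 a) iv2; lra.
pose e := expR (q / 16).
have e0 : 0 < e := expR_gt0 _.
have ew : expR `|w| <= e.
  rewrite ler_expR; apply: (le_trans wB).
  have -> : 4 * a * q = 4 * q * a by ring.
  have -> : q / 16 = 4 * q * (1 / 64) by field.
  by apply: ler_wpM2l => //; rewrite mulr_ge0.
have ew' : expR w <= e by apply: le_trans ew; rewrite ler_expR ler_norm.
have -> : expR (x ^+ 2 / 16) * expR (u ^+ 2 / 16) = e * e.
  by rewrite -!expRD; congr expR; rewrite /q; field.
have t1 : 1 <= e by rewrite -[leLHS]expR0 ler_expR divr_ge0.
have t2 : q / 16 <= e := le_expR _.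
have t3 : (q / 16) ^+ 2 <= 4 * e by apply: sqr_le_expR; rewrite divr_ge0.
rewrite mE rho2.
have -> : r^-1 * expR w - 1 - rho * (x * u) =
  (r^-1 - 1) * expR w + (expR w - 1 - w) + (w - rho * (x * u)) by ring.
have b1 : `|(r^-1 - 1) * expR w| <= 2 * a ^+ 2 * e.
  by rewrite normrM (ger0_norm (expR_ge0 w)); apply: ler_pM => //; exact: expR_ge0.
have b2 : `|expR w - 1 - w| <= 16 * a ^+ 2 * q ^+ 2 * e.
  apply: (le_trans (expR_taylor2_le w)); apply: ler_pM => //; [exact: sqr_ge0|].
  have -> : w ^+ 2 = `|w| ^+ 2 by rewrite real_normK ?num_real.
  have -> : 16 * a ^+ 2 * q ^+ 2 = (4 * a * q) ^+ 2 by ring.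
  by apply: lerXn2r => //; rewrite nnegrE; nonneg.
(* The dominant error: [16 q^2 = 64^2 (q / 16)^2] and [(q / 16)^2 <= 4 e]. The other two errors fit
   in the gap between [128^2] and [130^2]. *)
have b3 : 16 * a ^+ 2 * q ^+ 2 * e <= 128 ^+ 2 * a ^+ 2 * (e * e).
  have -> : 16 * a ^+ 2 * q ^+ 2 * e = 64 ^+ 2 * a ^+ 2 * e * (q / 16) ^+ 2 by field.
  have -> : 128 ^+ 2 * a ^+ 2 * (e * e) = 64 ^+ 2 * a ^+ 2 * e * (4 * e) by ring.
  by apply: ler_wpM2l => //; rewrite !mulr_ge0 ?sqr_ge0// ltW.
have b4 : 4 * a ^+ 2 * q <= 64 * a ^+ 2 * (e * e).
  have -> : 4 * a ^+ 2 * q = 64 * a ^+ 2 * (q / 16) by field.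
  by apply: ler_wpM2l; [rewrite mulr_ge0 ?sqr_ge0|nra].
have b5 : 2 * a ^+ 2 * e <= 2 * a ^+ 2 * (e * e).
  by apply: ler_wpM2l; [rewrite mulr_ge0 ?sqr_ge0|nra].
have n1 := ler_normD ((r^-1 - 1) * expR w + (expR w - 1 - w)) (w - rho * (x * u)).
have n2 := ler_normD ((r^-1 - 1) * expR w) (expR w - 1 - w).
have b6 : 0 <= a ^+ 2 * (e * e) by rewrite mulr_ge0 ?sqr_ge0// mulr_ge0// ltW.
have -> : 130 ^+ 2 * a ^+ 2 * (e * e) = 2 * a ^+ 2 * (e * e) + 128 ^+ 2 * a ^+ 2 * (e * e)
  + 64 * a ^+ 2 * (e * e) + 450 * (a ^+ 2 * (e * e)) by ring.
lra.
Qed.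

End PairCovariance.


(** * Second moments of pairs of even, centred functionals *)

Section PairBound.
Variable R : realType.
Local Notation gam := (normal_prob (0:R) 1).

(** Lets a signed term [D] of zero mean be discarded from a bound between nonnegative functions; if
    [B] has infinite integral the claim is trivial, otherwise everything is integrable. *)
Lemma integral_le_add_zero_mean (f B D : R -> R) :
  measurable_fun setT f -> measurable_fun setT B ->
  (forall x, 0 <= f x) -> (forall x, 0 <= B x) ->
  gam.-integrable setT (EFin \o D) -> (\int[gam]_x (D x)%:E = 0)%E ->
  (forall x, f x <= B x + D x) ->
  (\int[gam]_x (f x)%:E <= \int[gam]_x (B x)%:E)%E.
Proof.
move=> mf mB f0 B0 iD D0 fBD.
have [->|] := eqVneq (\int[gam]_x (B x)%:E)%E +oo%E; first exact: leey.
rewrite -ltey => Bfin.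
have iB : gam.-integrable setT (EFin \o B).
  apply/integrableP; split; first exact/measurable_EFinP.
  by under eq_integral do rewrite /= ger0_norm//.
have iBD := integrableD measurableT iB iD.
have if_ : gam.-integrable setT (EFin \o f).
  apply: (@le_integrable _ _ _ gam setT measurableT _ ((EFin \o B) \+ (EFin \o D))%E) => //.
    exact/measurable_EFinP.
  move=> x _; rewrite /= lee_fin ger0_norm//.
  by apply: (le_trans (fBD x)); exact: ler_norm.
apply: (@le_trans _ _ (\int[gam]_x ((EFin \o B) \+ (EFin \o D))%E x)%E).
  by apply: le_integral => // x _; rewrite /= -EFinD lee_fin.
by rewrite integralD// D0 adde0.
Qed.

Section Kernel.
Variables (g : R -> R) (M t : R).
Hypotheses (mg : measurable_fun setT g) (g_even : forall x, g (- x) = g x)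
  (g_mean : (\int[gam]_x (g x)%:E = 0)%E) (M0 : 0 <= M)
  (gM : forall x, `|g x| <= M * expR (x ^+ 2 / 16))
  (t0 : 0 <= t) (g_supp : forall x, `|x| < t -> g x = 0).

Local Notation m2 := (\int[gam]_x (g x ^+ 2)%:E)%E.

Lemma tail_expR (x : R) : t <= `|x| ->
  expR (x ^+ 2 / 8) <= expR (- (t ^+ 2) / 8) * expR (x ^+ 2 / 4).
Proof.
move=> tx; rewrite -expRD ler_expR.
have : t ^+ 2 <= `|x| ^+ 2 by apply: lerXn2r; rewrite ?nnegrE.
rewrite real_normK ?num_real//; lra.
Qed.

(** Because [g] vanishes on [|x| < t], half of the exponential slack between [x^2 / 8] and [x^2 / 4]
    can be traded for the factor [expR (- t^2 / 8)]. *)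
Lemma g_tail (x : R) :
  `|g x| * expR (x ^+ 2 / 16) <= M * expR (- (t ^+ 2) / 8) * expR (x ^+ 2 / 4).
Proof.
have [xt|tx] := ltP `|x| t.
  by rewrite (g_supp xt) normr0 mul0r !mulr_ge0 ?expR_ge0.
apply: (@le_trans _ _ (M * expR (x ^+ 2 / 8))).
  have -> : expR (x ^+ 2 / 8) = expR (x ^+ 2 / 16) * expR (x ^+ 2 / 16).
    by rewrite -expRD; congr expR; field.
  by rewrite mulrA; apply: ler_wpM2r (gM x); exact: expR_ge0.
by rewrite -mulrA; apply: ler_wpM2l => //; exact: tail_expR.
Qed.

Lemma g_sqr_tail (x : R) : g x ^+ 2 <= M ^+ 2 * expR (- (t ^+ 2) / 8) * expR (x ^+ 2 / 4).
Proof.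
have -> : g x ^+ 2 = `|g x| * `|g x| by rewrite -expr2 real_normK ?num_real.
apply: (@le_trans _ _ (`|g x| * (M * expR (x ^+ 2 / 16)))).
  by apply: ler_wpM2l.
rewrite mulrCA [leRHS](_ : _ = M * (M * expR (- (t ^+ 2) / 8) * expR (x ^+ 2 / 4))); last by ring.
by apply: ler_wpM2l => //; exact: g_tail.
Qed.

Lemma g_m2_le : (m2 <= (2 * (M ^+ 2 * expR (- (t ^+ 2) / 8)))%:E)%E.
Proof.
apply: gauss_integral_le_expR4 => [x|x|]; first exact: sqr_ge0.
  exact: g_sqr_tail.
by rewrite mulr_ge0 ?sqr_ge0 ?expR_ge0.
Qed.

Lemma g_integrable : gam.-integrable setT (EFin \o g).
Proof.
apply: (@gauss_integrable_le_expR4 R _ M) => // x; apply: (le_trans (gM x)).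
by apply: ler_wpM2l => //; rewrite ler_expR; have := sqr_ge0 x; lra.
Qed.

Lemma xg_integrable : gam.-integrable setT (EFin \o (fun x => x * g x)).
Proof.
apply: (@gauss_integrable_le_expR4 R _ (8 * M)) => [|x]; first by meas.
have x1 : `|x| <= 8 * expR (x ^+ 2 / 16).
  have := expR_ge1Dx (x ^+ 2 / 16).
  have -> : x ^+ 2 = `|x| ^+ 2 by rewrite real_normK ?num_real.
  have := sqr_ge0 (`|x| - 1); have := normr_ge0 x; nra.
rewrite normrM; apply: (@le_trans _ _ (8 * expR (x ^+ 2 / 16) * (M * expR (x ^+ 2 / 16)))).
  by apply: ler_pM.
have -> : 8 * expR (x ^+ 2 / 16) * (M * expR (x ^+ 2 / 16)) =
  8 * M * expR (x ^+ 2 / 8).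
  have -> : expR (x ^+ 2 / 8) = expR (x ^+ 2 / 16) * expR (x ^+ 2 / 16).
    by rewrite -expRD; congr expR; field.
  ring.
by apply: ler_wpM2l; [rewrite mulr_ge0|rewrite ler_expR; have := sqr_ge0 x; lra].
Qed.

(** Cancellation of orders 0 and 1 of the Mehler expansion: [g] is centred, and [x * g x] is odd. *)
Lemma g_affine_mean (k : R) : gam.-integrable setT (EFin \o (fun x => g x * (1 + k * x))) /\
  (\int[gam]_x (g x * (1 + k * x))%:E = 0)%E.
Proof.
have E : EFin \o (fun x => g x * (1 + k * x)) =
    ((EFin \o g) \+ (fun x => (k%:E * (EFin \o (fun y => y * g y)%R) x)%E))%E.
  by apply/funext => x /=; rewrite -EFinM -EFinD; congr EFin; ring.
have i2 := integrableZl measurableT k xg_integrable.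
split; first by rewrite E; exact: integrableD g_integrable i2.
rewrite -[LHS]/(\int[gam]_x (EFin \o (fun x => g x * (1 + k * x))%R) x)%E E.
rewrite integralD//; [|exact: g_integrable].
rewrite [X in (X + _)%E]g_mean add0e integralZl//; last exact: xg_integrable.
rewrite gauss_integral_odd ?mule0//; first exact: xg_integrable.
by move=> x; rewrite g_even mulNr.
Qed.

Lemma planar_second_g (rho r : R) (f : R -> R) : 0 <= r -> rho ^+ 2 + r ^+ 2 = 1 ->
  measurable_fun setT f -> (forall x, 0 <= f x) ->
  (\int[gam]_x \int[gam]_y (f (rho * x + r * y))%:E = \int[gam]_x (f x)%:E)%E.
Proof.
move=> r0 rr mf f0.
have rr' : r ^+ 2 + rho ^+ 2 = 1 by rewrite addrC.
have := @gauss_rotation R r rho (fun p => (f p.2)%:E) r0 rr'.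
move=> ->; last 2 first.
- by apply/measurable_EFinP/(measurableT_comp mf); meas.
- by move=> p; rewrite lee_fin.
exact: (gauss_integral_cst (\int[gam]_y (f y)%:E)%E).
Qed.

Lemma planar_pair_diag (al be rho r : R) : 0 <= r -> rho ^+ 2 + r ^+ 2 = 1 ->
  0 <= al -> 0 <= be ->
  (\int[gam]_x \int[gam]_y (al * g x ^+ 2 + be * g (rho * x + r * y) ^+ 2)%:E
   = al%:E * m2 + be%:E * m2)%E.
Proof.
move=> r0 rr al0 be0.
have mg2 : measurable_fun setT (fun x => g x ^+ 2) by meas.
transitivity (\int[gam]_x ((al * g x ^+ 2)%:E + \int[gam]_y (be * g (rho * x + r * y) ^+ 2)%:E))%E.
  apply: eq_integral => x _.
  under eq_integral do rewrite EFinD.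
  rewrite ge0_integralD//; [by rewrite gauss_integral_cst|..].
  - by move=> y _; rewrite lee_fin mulr_ge0// sqr_ge0.
  - by move=> y _; rewrite lee_fin mulr_ge0// sqr_ge0.
  - apply/measurable_EFinP; apply: measurable_funM; first by meas.
    by apply: (measurableT_comp mg2); meas.
have mF : measurable_fun setT (fun p : R * R => (be * g (rho * p.1 + r * p.2) ^+ 2)%:E).
  apply/measurable_EFinP; apply: measurable_funM; first by meas.
  by apply: (measurableT_comp mg2); meas.
rewrite ge0_integralD//; first last.
- apply: (@measurable_fun_fubini_tonelli_F _ _ _ _ _ gam _ mF) => p.
  by rewrite lee_fin mulr_ge0// sqr_ge0.
- by move=> x _; apply: integral_ge0 => y _; rewrite lee_fin mulr_ge0// sqr_ge0.
- by meas.
- by move=> x _; rewrite lee_fin mulr_ge0// sqr_ge0.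
rewrite (@planar_second_g rho r (fun u => be * g u ^+ 2))//; first last.
- by move=> x; rewrite mulr_ge0// sqr_ge0.
- by meas.
under eq_integral do rewrite EFinM.
rewrite ge0_integralZl//; [|side..].
congr (_ + _)%E.
under eq_integral do rewrite EFinM.
by rewrite ge0_integralZl//; side.
Qed.

Lemma pair_cov_large (al be rho r : R) : 1 / 64 <= `|rho| -> 0 <= r ->
  rho ^+ 2 + r ^+ 2 = 1 -> 0 <= al -> 0 <= be ->
  (\int[gam]_x \int[gam]_y ((al * g x + be * g (rho * x + r * y)) ^+ 2)%:E
   <= (al ^+ 2)%:E * m2 + (be ^+ 2)%:E * m2
      + (2 * al * be * (260 ^+ 2 * M ^+ 2 * rho ^+ 2 * expR (- (t ^+ 2) / 8)))%:E)%E.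
Proof.
move=> rho64 r0 rr al0 be0.
have ab0 : 0 <= al * be by rewrite mulr_ge0.
apply: (@le_trans _ _ (\int[gam]_x \int[gam]_y ((al ^+ 2 + al * be) * g x ^+ 2
    + (be ^+ 2 + al * be) * g (rho * x + r * y) ^+ 2)%:E)%E).
  apply: integral_le_nneg => x; first by apply: integral_ge0 => y _; rewrite lee_fin sqr_ge0.
  apply: integral_le_nneg => y; rewrite lee_fin ?sqr_ge0//.
  have := mulr_ge0 ab0 (sqr_ge0 (g x - g (rho * x + r * y))); nra.
rewrite planar_pair_diag//; [|by rewrite addr_ge0 ?sqr_ge0..].
have m20 : (0 <= m2)%E by apply: integral_ge0 => x _; rewrite lee_fin sqr_ge0.
have m2le := g_m2_le.
have m2f : m2 \is a fin_num.
  by rewrite ge0_fin_numE//; apply: le_lt_trans m2le (ltry _).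
have [m mE] : exists m : R, m2 = m%:E by exists (fine m2); rewrite fineK.
rewrite mE lee_fin in m2le; rewrite mE.
have ml := m2le.
rewrite -!EFinM -!EFinD lee_fin.
set e := expR _ in ml *.
have e0 : 0 <= e := expR_ge0 _.
have h : m <= 260 ^+ 2 * M ^+ 2 * rho ^+ 2 * e.
  apply: (le_trans ml).
  have -> : 2 * (M ^+ 2 * e) = (M ^+ 2 * e) * 2 by ring.
  have -> : 260 ^+ 2 * M ^+ 2 * rho ^+ 2 * e = (M ^+ 2 * e) * (260 ^+ 2 * rho ^+ 2) by ring.
  apply: ler_wpM2l; first by rewrite mulr_ge0 ?sqr_ge0.
  have : (1 / 64) ^+ 2 <= `|rho| ^+ 2 by apply: lerXn2r; rewrite ?nnegrE.
  rewrite real_normK ?num_real//; lra.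
have := ler_wpM2l ab0 h; lra.
Qed.

(** In the cross term the kernel is replaced by [1 + rho x u], whose contribution has zero mean in
    [u]; the [O(rho^2)] error is integrated using [g_tail] for both factors. Bounding the second
    moment of a weighted sum, rather than the covariance, keeps the integrands nonnegative. *)
Lemma pair_cov_small (al be rho r : R) : `|rho| <= 1 / 64 -> 0 < r ->
  rho ^+ 2 + r ^+ 2 = 1 -> 0 <= al -> 0 <= be ->
  (\int[gam]_x \int[gam]_y ((al * g x + be * g (rho * x + r * y)) ^+ 2)%:E
   <= (al ^+ 2)%:E * m2 + (be ^+ 2)%:E * m2
      + (2 * al * be * (260 ^+ 2 * M ^+ 2 * rho ^+ 2 * expR (- (t ^+ 2) / 8)))%:E)%E.
Proof.
move=> rho64 r0 rr al0 be0.
have ab0 : 0 <= al * be by rewrite mulr_ge0.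
have r0' := ltW r0.
pose T := expR (- (t ^+ 2) / 8).
have T0 : 0 <= T := expR_ge0 _.
pose k := 2 * al * be * (130 ^+ 2 * rho ^+ 2 * (M * T) ^+ 2).
have k0 : 0 <= k by rewrite /k; nonneg.
pose e4 (x : R) := expR (x ^+ 2 / 4).
have me4 : measurable_fun setT e4 by rewrite /e4; meas.
have e40 x : 0 <= e4 x by exact: expR_ge0.
have mF2 : measurable_fun setT (fun p : R * R => al ^+ 2 * g p.1 ^+ 2 + be ^+ 2 * g (rho * p.1 + r * p.2) ^+ 2).
  apply: measurable_funD; apply: measurable_funM; try exact: measurable_cst.
    by apply: measurable_funX; apply: (measurableT_comp mg); meas.
  by apply: measurable_funX; apply: (measurableT_comp mg); meas.
have F20 (x y : R) : 0 <= al ^+ 2 * g x ^+ 2 + be ^+ 2 * g y ^+ 2.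
  by rewrite addr_ge0// mulr_ge0// sqr_ge0.
have inner x : (\int[gam]_y ((al * g x + be * g (rho * x + r * y)) ^+ 2)%:E <=
   \int[gam]_y (al ^+ 2 * g x ^+ 2 + be ^+ 2 * g (rho * x + r * y) ^+ 2)%:E
   + (k * Num.sqrt 2 * e4 x)%:E)%E.
  rewrite (@gauss_integral_mehler R rho r x (fun u => ((al * g x + be * g u) ^+ 2)%:E))//; first last.
  - by move=> u; rewrite lee_fin sqr_ge0.
  - by meas.
  rewrite (@gauss_integral_mehler R rho r x (fun u => (al ^+ 2 * g x ^+ 2 + be ^+ 2 * g u ^+ 2)%:E))//; first last.
  - by move=> u; rewrite lee_fin.
  - by meas.
  have -> : ((k * Num.sqrt 2 * e4 x)%:E = \int[gam]_u (k * e4 x * e4 u)%:E)%E.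
    under eq_integral do rewrite EFinM.
    rewrite ge0_integralZl//; [|side..].
    rewrite gauss_integral_expR4E -EFinM; congr EFin; ring.
  have mm : measurable_fun setT (mehler rho r x) by rewrite /mehler; meas.
  rewrite -ge0_integralD//; first last.
  - by meas.
  - by move=> u _; rewrite lee_fin; apply: mulr_ge0 => //; apply: mulr_ge0.
  - by meas.
  - by move=> u _; rewrite -EFinM lee_fin mulr_ge0// mehler_ge0.
  under eq_integral do rewrite -EFinM.
  under [leRHS]eq_integral do rewrite -?EFinM -EFinD.
  have [iD D0] := g_affine_mean (rho * x).
  apply: (@integral_le_add_zero_mean _ _ (fun u => 2 * al * be * g x * (g u * (1 + rho * x * u)))).
  - by meas.
  - by meas.
  - by move=> u; rewrite mulr_ge0 ?sqr_ge0// mehler_ge0.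
  - by move=> u; rewrite addr_ge0//; [rewrite mulr_ge0// mehler_ge0|by apply: mulr_ge0 => //; apply: mulr_ge0].
  - have := integrableZl measurableT (2 * al * be * g x) iD.
    by under eq_fun do rewrite /= -EFinM.
  - under eq_integral do rewrite EFinM.
    by rewrite integralZl// D0 mule0.
  move=> u.
  have kK := mehler_approx x u rho64 r0 rr.
  set K := mehler rho r x u in kK *.
  have -> : (al * g x + be * g u) ^+ 2 * K =
    (al ^+ 2 * g x ^+ 2 + be ^+ 2 * g u ^+ 2) * K + 2 * (al * be) * (g x * g u * (K - 1 - rho * (x * u)))
    + 2 * al * be * g x * (g u * (1 + rho * x * u)) by ring.
  rewrite lerD2r lerD2l.
  have -> : k * e4 x * e4 u = 2 * (al * be) * (130 ^+ 2 * rho ^+ 2 * ((M * T * e4 x) * (M * T * e4 u))).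
    by rewrite /k; ring.
  apply: ler_wpM2l; first by rewrite mulr_ge0.
  apply: (le_trans (ler_norm _)); rewrite !normrM.
  apply: (@le_trans _ _ (`|g x| * `|g u| * (130 ^+ 2 * rho ^+ 2 * (expR (x ^+ 2 / 16) * expR (u ^+ 2 / 16))))).
    by apply: ler_wpM2l => //; rewrite mulr_ge0.
  have -> : `|g x| * `|g u| * (130 ^+ 2 * rho ^+ 2 * (expR (x ^+ 2 / 16) * expR (u ^+ 2 / 16))) =
    130 ^+ 2 * rho ^+ 2 * ((`|g x| * expR (x ^+ 2 / 16)) * (`|g u| * expR (u ^+ 2 / 16))) by ring.
  apply: ler_wpM2l; first by rewrite mulr_ge0// sqr_ge0.
  by apply: ler_pM; rewrite ?mulr_ge0 ?expR_ge0//; exact: g_tail.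
apply: (@le_trans _ _ (\int[gam]_x (\int[gam]_y (al ^+ 2 * g x ^+ 2 + be ^+ 2 * g (rho * x + r * y) ^+ 2)%:E
   + (k * Num.sqrt 2 * e4 x)%:E))%E).
  apply: integral_le_nneg => // x.
  by apply: integral_ge0 => y _; rewrite lee_fin sqr_ge0.
rewrite ge0_integralD//; first last.
- by meas.
- by move=> x _; rewrite lee_fin; apply: mulr_ge0 => //; apply: mulr_ge0 => //; exact: sqrtr_ge0.
- apply: (@measurable_fun_fubini_tonelli_F _ _ _ _ _ gam
    (fun p : R * R => (al ^+ 2 * g p.1 ^+ 2 + be ^+ 2 * g (rho * p.1 + r * p.2) ^+ 2)%:E)).
    exact/measurable_EFinP.
  by move=> p; rewrite lee_fin.
- by move=> x _; apply: integral_ge0 => y _; rewrite lee_fin.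
rewrite planar_pair_diag ?sqr_ge0//.
apply: leeD => //.
under eq_integral do rewrite EFinM.
rewrite ge0_integralZl//; [|first [by meas | by move=> x _; rewrite lee_fin | by rewrite lee_fin mulr_ge0// sqrtr_ge0]..].
rewrite gauss_integral_expR4E -EFinM lee_fin.
have -> : k * Num.sqrt 2 * Num.sqrt 2 = k * (Num.sqrt 2 ^+ 2) by ring.
rewrite sqr_sqrtr//.
(* Both factors [g] contribute a [T]; one of them is dropped, and [2 * 130^2 <= 260^2]. *)
have T1 : T <= 1 by rewrite /T expR_le1 mulNr oppr_le0 divr_ge0// sqr_ge0.
have -> : k * 2 = 2 * al * be * ((2 * 130 ^+ 2) * M ^+ 2 * rho ^+ 2 * T * T) by rewrite /k; ring.
apply: ler_wpM2l; first by rewrite !mulr_ge0.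
have P0 : 0 <= M ^+ 2 * rho ^+ 2 * T by nonneg.
have := ler_wpM2l P0 T1; rewrite mulr1 -/T; lra.
Qed.

End Kernel.
End PairBound.


(** * The thresholded square and its centring constant *)

Section TruncatedMoment.
Variable R : realType.
Local Notation gam := (normal_prob (0:R) 1).
Local Notation mu := (@lebesgue_measure R).
Local Notation phi := (normal_pdf (0:R) 1).
Variable t : R.
Hypothesis t1 : 1 <= t.
Local Notation D := [set x : R | t <= `|x|].

Let t0 : 0 < t. Proof. exact: lt_le_trans t1. Qed.

Let mD : measurable D.
Proof.
have -> : D = (fun x : R => `|x|) @^-1` `[t, +oo[.
  by apply/seteqP; split => x /=; rewrite in_itv/= andbT.
by rewrite -[X in measurable X]setTI; apply: normr_measurable.
Qed.

Let mD' : measurable [set x : R | t < `|x|].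
Proof.
have -> : [set x : R | t < `|x|] = (fun x : R => `|x|) @^-1` `]t, +oo[.
  by apply/seteqP; split => x /=; rewrite in_itv/= andbT.
by rewrite -[X in measurable X]setTI; apply: normr_measurable.
Qed.

(** The interval [[t, 2t]] has length at least 1, and there the density is at least its value at
    [2t]. *)
Lemma gauss_tail_ge : ((1 / 3 * expR (- (2 * t ^+ 2)))%:E <= gam D)%E.
Proof.
have t0' := t0; have t2 : t < 2 * t by lra.
apply: (@le_trans _ _ (gam `[t, 2 * t]%classic)); last first.
  apply: le_measure; rewrite ?inE//= => x /=; rewrite in_itv/= => /andP[tx _].
  by apply: (le_trans tx); exact: ler_norm.
apply: (@le_trans _ _ (\int[mu]_(x in `[t, (2 * t)%R]) (phi (2 * t)%R)%:E)%E); last first.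
  apply: ge0_le_integral => //=.
  - by move=> x _; rewrite lee_fin normal_pdf_ge0.
  - exact: measurable_phiE.
  - move=> x; rewrite in_itv/= => /andP[tx x2t]; rewrite lee_fin !normal_pdf01E.
    apply: ler_wpM2l; first exact: normal_peak_ge0.
    rewrite ler_expR; nra.
rewrite integral_cst//= lebesgue_measure_itv/= lte_fin t2 -EFinD -EFinM lee_fin.
rewrite normal_pdf01E.
have -> : - (2 * t) ^+ 2 / 2 = - (2 * t ^+ 2) by field.
have -> : 2 * t - t = t by ring.
have e0 := expR_ge0 (- (2 * t ^+ 2)).
apply: (@le_trans _ _ (normal_peak 1 * expR (- (2 * t ^+ 2)))).
  by apply: ler_wpM2r => //; exact: normal_peak1_ge.
by apply: ler_peMr => //; rewrite mulr_ge0// normal_peak_ge0.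
Qed.

Lemma gauss_tail_fin : gam D \is a fin_num.
Proof.
rewrite ge0_fin_numE//.
by apply: le_lt_trans (ltry 1); exact: probability_le1.
Qed.

(** For [|x| <= 4t] use [x^2 <= 16 t^2]. Beyond, [x^2 <= 8 expR (- 2 t^2) expR (x^2 / 4)], whose
    integral is at most [16 expR (- 2 t^2)], hence at most [48 gam D] by [gauss_tail_ge]; and
    [16 + 48 = 64]. *)
Lemma gauss_tail_sqr_le : (\int[gam]_(x in D) (x ^+ 2)%:E <= (64 * t ^+ 2)%:E * gam D)%E.
Proof.
have pw x : x ^+ 2 <= 16 * t ^+ 2 + 8 * expR (- (2 * t ^+ 2)) * expR (x ^+ 2 / 4).
  have [x4|x4] := leP `|x| (4 * t).
    have : x ^+ 2 <= (4 * t) ^+ 2.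
      rewrite -[x ^+ 2]real_normK ?num_real//.
      by apply: lerXn2r => //; rewrite nnegrE ?mulr_ge0// ltW.
    have : 0 <= 8 * expR (- (2 * t ^+ 2)) * expR (x ^+ 2 / 4) by nonneg.
    lra.
  have h1 := le_expR (x ^+ 2 / 8).
  have h2 : expR (x ^+ 2 / 8) <= expR (- (2 * t ^+ 2)) * expR (x ^+ 2 / 4).
    rewrite -expRD ler_expR.
    have : (4 * t) ^+ 2 <= `|x| ^+ 2.
      by apply: lerXn2r; [rewrite nnegrE mulr_ge0// ltW|rewrite nnegrE|exact: ltW].
    rewrite real_normK ?num_real//; lra.
  have := sqr_ge0 t; lra.
apply: (@le_trans _ _ (\int[gam]_(x in D) ((16 * t ^+ 2)%:E
     + (8 * expR (- (2 * t ^+ 2)))%:E * (expR (x ^+ 2 / 4))%:E))%E).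
  apply: ge0_le_integral => //=.
  - by move=> x _; rewrite lee_fin sqr_ge0.
  - by apply: measurable_funTS; meas.
  - by apply: measurable_funTS; meas.
  - by move=> x _; rewrite -EFinM -EFinD lee_fin.
have me : measurable_fun D (fun x : R => (expR (x ^+ 2 / 4))%:E).
  by apply: measurable_funTS; meas.
rewrite ge0_integralD//; [|first [by apply: measurable_funTS; meas
  | by move=> x _; rewrite -?EFinM lee_fin; nonneg]..].
rewrite integral_cst// ge0_integralZl//; [|by rewrite lee_fin; nonneg..].
have e4 : (\int[gam]_(x in D) (expR (x ^+ 2 / 4))%:E <= 2%:E)%E.
  apply: le_trans (gauss_integral_expR4 R).
  by apply: ge0_subset_integral => //; meas.
have tl := gauss_tail_ge.
have [p pE] : exists p : R, gam D = p%:E.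
  by exists (fine (gam D)); rewrite fineK// gauss_tail_fin.
rewrite pE lee_fin in tl.
apply: (@le_trans _ _ ((16 * t ^+ 2)%:E * gam D + (8 * expR (- (2 * t ^+ 2)))%:E * 2%:E)%E).
  apply: leeD => //; apply: lee_wpmul2l => //; rewrite lee_fin; nonneg.
rewrite pE -!EFinM -EFinD lee_fin.
have p0 : 0 <= p by apply: le_trans tl; nonneg.
have t21 : 1 <= t ^+ 2 by rewrite exprn_ege1.
have := ler_wpM2r p0 t21; lra.
Qed.

Lemma beta_fine : exists p a : R, [/\ gam D = p%:E, 0 < p,
  (\int[gam]_(x in D) (x ^+ 2)%:E)%E = a%:E, beta t = a / p & 0 <= a <= 64 * t ^+ 2 * p].
Proof.
have pE : gam D = (fine (gam D))%:E by rewrite fineK// gauss_tail_fin.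
have := gauss_tail_sqr_le; have := gauss_tail_ge.
move: (fine (gam D)) pE => p pE; rewrite pE lee_fin => lp la.
have a0 : (0 <= \int[gam]_(x in D) (x ^+ 2)%:E)%E.
  by apply: integral_ge0 => x _; rewrite lee_fin sqr_ge0.
have aE : (\int[gam]_(x in D) (x ^+ 2)%:E)%E = (fine (\int[gam]_(x in D) (x ^+ 2)%:E)%E)%:E.
  by rewrite fineK// ge0_fin_numE//; apply: le_lt_trans la _; rewrite -EFinM ltry.
exists p, (fine (\int[gam]_(x in D) (x ^+ 2)%:E)%E); split => //.
- by apply: lt_le_trans lp; rewrite mulr_gt0 ?expR_gt0//; lra.
- by rewrite /beta pE.
- by rewrite -!lee_fin -aE a0/= EFinM.
Qed.

Lemma beta_bounds : 0 <= beta t <= 64 * t ^+ 2.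
Proof.
have [p [a [_ p0 _ -> /andP[a0 ale]]]] := beta_fine.
by apply/andP; split; [exact: divr_ge0 a0 (ltW p0)|rewrite ler_pdivrMr].
Qed.

Definition threshold_fun (b x : R) : R := (x ^+ 2 - b) * (if t < `|x| then 1 else 0).

Lemma threshold_fun_indic b x :
  threshold_fun b x = (x ^+ 2 - b) * \1_[set x : R | t < `|x|] x.
Proof.
rewrite /threshold_fun indicE; congr (_ * _).
by case: ifPn => h; [rewrite mem_set//|rewrite memNset//=; apply/negP].
Qed.

Lemma measurable_threshold_fun b : measurable_fun setT (threshold_fun b).
Proof.
have -> : threshold_fun b = (fun x => (x ^+ 2 - b) * \1_[set x : R | t < `|x|] x).
  by apply/funext => x; exact: threshold_fun_indic.
apply: measurable_funM; first by meas.
exact: measurable_indic.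
Qed.

(** [beta t] is the mean of [x^2] conditional on [t <= |x|], so subtracting it centres the square on
    that event. *)
Lemma threshold_fun_mean : (\int[gam]_x (threshold_fun (beta t) x)%:E = 0)%E.
Proof.
have [p [a [pE p0 aE bE _]]] := beta_fine.
set b := beta t in bE *.
have mb : measurable_fun setT (fun x : R => (x ^+ 2 - b)%:E) by meas.
transitivity (\int[gam]_(x in D) (x ^+ 2 - b)%:E)%E.
  rewrite [RHS]integral_mkcond.
  apply: ae_eq_integral => //.
  - by apply/measurable_EFinP; exact: measurable_threshold_fun.
  - apply/(measurable_restrictT _ _).1 => //; exact: measurable_funTS.
  (* The estimator thresholds with a strict inequality and [beta] conditions on a weak one; they
     differ on a null set. *)
  exists ([set t] `|` [set - t]); split.
  - exact: measurableU.
  - apply: null_set_integral => //=.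
    + exact: measurableU.
    + exact: measurable_phiE.
    + apply: countable_lebesgue_measure0; apply: finite_set_countable; rewrite finite_setU; split; exact: finite_set1.
  move=> x /= /not_implyP[_ /eqP]; apply: contraNP => /not_orP[/eqP xt /eqP xt'].
  rewrite patchE /threshold_fun.
  have nt : `|x| != t.
    by rewrite eqr_norml negb_and (negbTE xt) (negbTE xt').
  have [h|h] := ltP t `|x|.
    by rewrite mem_set ?mulr1//= ltW.
  by rewrite memNset ?mulr0//= leNgt lt_neqAle nt h.
have i1 : gam.-integrable D (fun x : R => (x ^+ 2)%:E).
  apply/integrableP; split; first by apply: measurable_funTS; meas.
  have -> : (\int[gam]_(x in D) `|(x ^+ 2)%:E| = \int[gam]_(x in D) (x ^+ 2)%:E)%E.
    by apply: eq_integral => x _; rewrite gee0_abs// lee_fin sqr_ge0.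
  by rewrite aE ltry.
have i2 : gam.-integrable D (fun x : R => b%:E).
  apply/integrableP; split => //.
  have -> : (\int[gam]_(x in D) `|b%:E| = `|b%:E| * gam D)%E by rewrite -integral_cst.
  by rewrite pE /= -EFinM ltry.
under eq_integral do rewrite EFinB.
have bI : (\int[gam]_(x in D) b%:E = b%:E * gam D)%E by rewrite integral_cst.
rewrite integralB// aE bI pE -EFinM -EFinB bE divfK ?subrr//.
exact: lt0r_neq0.
Qed.

Lemma threshold_fun_even x : threshold_fun (beta t) (- x) = threshold_fun (beta t) x.
Proof. by rewrite /threshold_fun sqrrN normrN. Qed.

Lemma threshold_fun_supp x : `|x| < t -> threshold_fun (beta t) x = 0.
Proof. by move=> xt; rewrite /threshold_fun ltNge (ltW xt)/= mulr0. Qed.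

(** Where the function is nonzero, [beta t <= 64 t^2 <= 64 x^2] and [x^2 <= 16 expR (x^2 / 16)]; the
    resulting constant does not depend on [t]. *)
Lemma threshold_fun_le x : `|threshold_fun (beta t) x| <= 33 ^+ 2 * expR (x ^+ 2 / 16).
Proof.
have /andP[b0 b1] := beta_bounds.
have x20 := sqr_ge0 x.
rewrite /threshold_fun; case: ifPn => [tx|_]; last first.
  by rewrite mulr0 normr0 mulr_ge0 ?sqr_ge0 ?expR_ge0.
rewrite mulr1; have h := le_expR (x ^+ 2 / 16).
have : t ^+ 2 <= x ^+ 2.
  rewrite -[leRHS]real_normK ?num_real//.
  by apply: lerXn2r; [rewrite nnegrE ltW|rewrite nnegrE|exact: ltW].
rewrite ler_norml => h2; apply/andP; split; lra.
Qed.

End TruncatedMoment.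


(** * Quadratic forms and the largest eigenvalue *)

Section Rayleigh.
Variable R : realType.

Definition bilform n (M : 'M[R]_n) (v w : 'rV[R]_n) : R := (v *m M *m w^T) ord0 ord0.

Lemma bilformE n (M : 'M[R]_n) v w :
  bilform M v w = \sum_i \sum_j v ord0 i * M i j * w ord0 j.
Proof.
rewrite /bilform mxE exchange_big; apply: eq_bigr => j _.
by rewrite !mxE mulr_suml.
Qed.

Lemma bilformC n (M : 'M[R]_n) v w : M^T = M -> bilform M v w = bilform M w v.
Proof.
move=> MT; rewrite /bilform -[in RHS]MT.
have -> : w *m M^T *m v^T = (v *m M *m w^T)^T by rewrite !trmx_mul trmxK mulmxA.
by rewrite [RHS]mxE.
Qed.

Lemma bilformDZ n (M : 'M[R]_n) (a b : R) v w : M^T = M ->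
  bilform M (a *: v + b *: w) (a *: v + b *: w) =
  a ^+ 2 * bilform M v v + 2 * a * b * bilform M v w + b ^+ 2 * bilform M w w.
Proof.
move=> MT.
have E : bilform M (a *: v + b *: w) (a *: v + b *: w) =
  a ^+ 2 * bilform M v v + a * b * bilform M v w + a * b * bilform M w v
  + b ^+ 2 * bilform M w w.
  rewrite /bilform !(mulmxDl, mulmxDr, linearD, linearZ)/= .
  rewrite -?scalemxAl -?scalemxAr !mxE; ring.
by rewrite E (bilformC w v MT); ring.
Qed.

Lemma bilform_cauchy_schwarz n (M : 'M[R]_n) v w : M^T = M ->
  (forall u, 0 <= bilform M u u) ->
  bilform M v w ^+ 2 <= bilform M v v * bilform M w w.
Proof.
move=> MT P.
have a0 := P v; have c0 := P w.
(* The first two vectors settle the cases where one diagonal value is positive; [v + w] and [v - w]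
   settle the case where both vanish. *)
have h1 := P (bilform M w w *: v + (- bilform M v w) *: w).
have h2 := P (- bilform M v w *: v + bilform M v v *: w).
have h3 := P (1 *: v + 1 *: w).
have h4 := P (1 *: v + (-1) *: w).
rewrite !bilformDZ// in h1 h2 h3 h4.
set a := bilform M v v in a0 h1 h2 h3 h4 *.
set b := bilform M v w in h1 h2 h3 h4 *.
set c := bilform M w w in c0 h1 h2 h3 h4 *.
have k1 : 0 <= c * (a * c - b ^+ 2) by apply: (le_trans h1); lra.
have k2 : 0 <= a * (a * c - b ^+ 2) by apply: (le_trans h2); lra.
rewrite -subr_ge0.
have [cp|cn] := ltP 0 c; first by rewrite pmulr_rge0 in k1.
have [ap|an] := ltP 0 a; first by rewrite pmulr_rge0 in k2.
have cE : c = 0 by lra.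
have aE : a = 0 by lra.
have -> : b = 0 by lra.
by rewrite aE cE; lra.
Qed.

Definition sqr_rv n (v : 'rV[R]_n) : R := \sum_i v ord0 i ^+ 2.

Lemma sqr_rv_ge0 n (v : 'rV[R]_n) : 0 <= sqr_rv v.
Proof. by apply: sumr_ge0 => i _; exact: sqr_ge0. Qed.

Lemma sqr_rv_eq0 n (v : 'rV[R]_n) : (sqr_rv v == 0) = (v == 0).
Proof.
apply/idP/eqP => [|->]; last first.
  by rewrite /sqr_rv big1// => i _; rewrite mxE expr0n.
rewrite psumr_eq0; last by move=> i _; exact: sqr_ge0.
move/allP => h; apply/rowP => i; rewrite mxE; apply/eqP.
by have := h i (mem_index_enum i); rewrite sqrf_eq0.
Qed.

Lemma sqr_rvE n (v : 'rV[R]_n) : sqr_rv v = (v *m v^T) ord0 ord0.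
Proof. by rewrite mxE; apply: eq_bigr => i _; rewrite mxE expr2. Qed.

Lemma bilform_bound n (M : 'M[R]_n) :
  exists2 K : R, 0 < K & forall v, bilform M v v <= K * sqr_rv v.
Proof.
exists (1 + \sum_i \sum_j `|M i j|).
  by rewrite ltr_pwDl// sumr_ge0// => i _; rewrite sumr_ge0.
move=> v; have v0 := sqr_rv_ge0 v.
rewrite mulrDl mul1r; apply: ler_wpDl => //.
rewrite bilformE mulr_suml; apply: ler_sum => i _.
rewrite mulr_suml; apply: ler_sum => j _.
apply: (le_trans (ler_norm _)).
rewrite !normrM mulrAC mulrC; apply: ler_wpM2l => //.
have le1 k : `|v ord0 k| ^+ 2 <= sqr_rv v.
  rewrite real_normK ?num_real// /sqr_rv (bigD1 k)//= lerDl.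
  by apply: sumr_ge0 => l _; exact: sqr_ge0.
have := le1 i; have := le1 j; have := sqr_ge0 (`|v ord0 i| - `|v ord0 j|); nra.
Qed.

Lemma bilform_scal n (M : 'M[R]_n) (l : R) v :
  bilform (l%:M - M) v v = l * sqr_rv v - bilform M v v.
Proof.
rewrite /bilform mulmxBr mulmxBl mul_mx_scalar -scalemxAl.
by rewrite sqr_rvE !mxE; congr (_ - _).
Qed.

Lemma singular_kernel n (M : 'M[R]_n) : M \notin unitmx ->
  exists2 u : 'rV[R]_n, u != 0 & u *m M = 0.
Proof.
rewrite -row_free_unit -kermx_eq0 => /rowV0Pn[u uK u0].
by exists u => //; apply/sub_kermxP.
Qed.

(* If [l] is the supremum of the Rayleigh quotient then [l%:M - M] is positive
   semidefinite but not coercive, hence singular. *)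
Lemma bilform_le_lambda_max n (M : 'M[R]_n) v : M^T = M ->
  bilform M v v <= lambda_max M * sqr_rv v.
Proof.
move=> MT.
have [->|v0] := eqVneq v 0.
  have -> : sqr_rv (0 : 'rV[R]_n) = 0 by apply/eqP; rewrite sqr_rv_eq0.
  by rewrite /bilform !mul0mx mxE mulr0.
have pos (w : 'rV[R]_n) : w != 0 -> 0 < sqr_rv w.
  by move=> w0; rewrite lt_def sqr_rv_eq0 w0 sqr_rv_ge0.
pose Q := [set bilform M w w / sqr_rv w | w in [set w : 'rV[R]_n | w != 0]].
have [K K0 KM] := bilform_bound M.
have supQ : has_sup Q.
  split; first by exists (bilform M v v / sqr_rv v); exists v.
  exists K => _ [w w0 <-]; rewrite ler_pdivrMr//; exact: pos.
set l := sup Q.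
have lw w : bilform M w w <= l * sqr_rv w.
  have [->|w0] := eqVneq w 0.
    have -> : sqr_rv (0 : 'rV[R]_n) = 0 by apply/eqP; rewrite sqr_rv_eq0.
    by rewrite /bilform !mul0mx mxE mulr0.
  rewrite -ler_pdivrMr; last exact: pos.
  by apply: sup_upper_bound => //; exists w.
pose N := l%:M - M.
have NT : N^T = N by rewrite /N linearB/= tr_scalar_mx MT.
have Npos u : 0 <= bilform N u u by rewrite bilform_scal subr_ge0.
have eigl : eigenvalue M l.
  have [|/singular_kernel[u u0 uN]] := boolP (N \in unitmx); last first.
    apply/eigenvalueP; exists u => //.
    by move/eqP: uN; rewrite mulmxBr mul_mx_scalar subr_eq0 => /eqP.
  move=> Nu.
  (* If [N] were invertible, Cauchy-Schwarz for its form, applied to [w] and [w *m invmx N], would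
     bound that form below by [sqr_rv w / K'], so [l] could be lowered by [1 / K']. *)
  have [K' K'0 KN] := bilform_bound (invmx N)^T.
  have : sup Q <= l - K'^-1.
    apply: ge_sup; first by case: supQ.
    move=> _ [w w0 <-]; have wp := pos _ w0.
    rewrite ler_pdivrMr// mulrBl.
    suff : K'^-1 * sqr_rv w <= bilform N w w by rewrite bilform_scal; lra.
    rewrite mulrC ler_pdivrMr//.
    pose y := w *m invmx N.
    have yN : y *m N = w by rewrite /y mulmxKV.
    have E1 : bilform N y w = sqr_rv w by rewrite /bilform yN sqr_rvE.
    have E2 : bilform N y y = bilform (invmx N)^T w w.
      by rewrite /bilform yN /y trmx_mul mulmxA.
    have := bilform_cauchy_schwarz y w NT Npos; rewrite E1 E2.
    have := ler_wpM2r (Npos w) (KN w).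
    move=> h1 h2; have := le_trans h2 h1; rewrite expr2.
    have -> : K' * sqr_rv w * bilform N w w = sqr_rv w * (bilform N w w * K') by ring.
    by rewrite (ler_pM2l wp).
  rewrite -/l; have : 0 < K'^-1 by rewrite invr_gt0.
  by move=> k1; rewrite lerBrDr gerDl leNgt k1.
have supE : has_sup [set a | eigenvalue M a].
  split; first by exists l.
  exists l => a /= /eigenvalueP[u ua u0].
  have := lw u; rewrite /bilform ua -scalemxAl mxE -sqr_rvE.
  by rewrite ler_pM2r// pos.
apply: (le_trans (lw v)); apply: ler_wpM2r; first exact: sqr_rv_ge0.
exact: sup_upper_bound.
Qed.

Lemma sqr_sum_le (I : finType) (P : pred I) (x y : I -> R) :
  (\sum_(i | P i) x i * y i) ^+ 2 <= (\sum_(i | P i) x i ^+ 2) * (\sum_(i | P i) y i ^+ 2).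
Proof.
set a := \sum_(i | P i) x i ^+ 2; set c := \sum_(i | P i) y i ^+ 2.
set b := \sum_(i | P i) x i * y i.
have a0 : 0 <= a by apply: sumr_ge0 => i _; exact: sqr_ge0.
have key (s t : R) : 0 <= s ^+ 2 * a + 2 * s * t * b + t ^+ 2 * c.
  rewrite /a /b /c !mulr_sumr -!big_split; apply: sumr_ge0 => i _ /=.
  have -> : s ^+ 2 * x i ^+ 2 + 2 * s * t * (x i * y i) + t ^+ 2 * y i ^+ 2 = (s * x i + t * y i) ^+ 2 by ring.
  exact: sqr_ge0.
have h1 := key (- b) a.
have k : 0 <= a * (a * c - b ^+ 2) by apply: (le_trans h1); lra.
rewrite -subr_ge0; have [ap|an] := ltP 0 a; first by rewrite pmulr_rge0 in k.
have aE : a = 0 by lra.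
(* With [a = 0] this choice makes the quadratic expression equal to [- b^2], so [b = 0]. *)
have h2 := key (- (c + 1) / 2) b; have h3 := sqr_ge0 b; have c0 := key 0 1.
rewrite aE in h2 c0 *; nra.
Qed.

End Rayleigh.


(** * Expectations of functions of linear forms *)

Section Expectation.
Variables (R : realType) (d : nat).
Local Notation gam := (normal_prob (0:R) 1).
Local Notation EE := (@gauss_expect R d).

Definition dotz (a : 'I_d -> R) (z : nat -> R) : R := \sum_(j < d) a j * z j.

(** Extension by zero to all of [nat], the index type over which [iter_gauss_planar] is proved by
    induction. *)
Definition ext0 (a : 'I_d -> R) (j : nat) : R := oapp a 0 (insub j).

Lemma ext0E a (j : 'I_d) : ext0 a j = a j.
Proof. by rewrite /ext0 valK. Qed.

Lemma ext0_dotz a (z : nat -> R) : \sum_(j < d) ext0 a j * z j = dotz a z.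
Proof. by apply: eq_bigr => j _; rewrite ext0E. Qed.

Lemma planar_coef_ext0 a b c : planar_coef d (ext0 a) (ext0 b) c ->
  [/\ 0 <= c.1.1 /\ 0 <= c.2, c.1.1 ^+ 2 = \sum_(j < d) a j ^+ 2,
     c.1.1 * c.1.2 = \sum_(j < d) a j * b j &
     c.1.2 ^+ 2 + c.2 ^+ 2 = \sum_(j < d) b j ^+ 2].
Proof.
case=> h0 h1 h2 h3; split => //.
- by rewrite h1; apply: eq_bigr => j _; rewrite ext0E.
- by rewrite h2; apply: eq_bigr => j _; rewrite !ext0E.
- by rewrite h3; apply: eq_bigr => j _; rewrite ext0E.
Qed.

Definition planar_fun (a b : 'I_d -> R) (h : R * R -> \bar R) (z : nat -> R) : \bar R :=
  h (dotz a z, dotz b z).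

Section Family.
Variables (K : finType) (a b : K -> 'I_d -> R) (h : K -> R * R -> \bar R).
Hypotheses (mh : forall k, measurable_fun setT (h k)) (h0 : forall k u, (0 <= h k u)%E).

Lemma gauss_expect_planar_family : exists c : K -> R * R * R,
  [/\ forall k, planar_coef d (ext0 (a k)) (ext0 (b k)) (c k),
      forall k, EE (planar_fun (a k) (b k) (h k)) =
        planar_law (c k).1.1 (c k).1.2 (c k).2 (h k) &
      EE (fun z => \sum_k planar_fun (a k) (b k) (h k) z)%E =
        (\sum_k EE (planar_fun (a k) (b k) (h k)))%E].
Proof.
have [c [cP cE]] := iter_gauss_planar (fun k => ext0 (a k)) (fun k => ext0 (b k)) d.
have one k : EE (planar_fun (a k) (b k) (h k)) =
    planar_law (c k).1.1 (c k).1.2 (c k).2 (h k).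
  (* The coefficients [c] do not depend on [h], so replacing every other function by zero isolates
     the term [k]. *)
  have := cE (fun k' => if k' == k then h k' else cst 0%E) (fun _ => 0).
  have -> : EE (planar_fun (a k) (b k) (h k)) = iter_gauss d (fun w => \sum_k0
     (if k0 == k then h k0 else cst 0%E) (\sum_(j < d) ext0 (a k0) j * w j,
       \sum_(j < d) ext0 (b k0) j * w j)%R)%E (fun _ => 0).
    apply: eq_iter_gauss => w _; rewrite (bigD1 k)//= eqxx [X in (_ + X)%E]big1; last first.
      by move=> k' /negbTE ->.
    by rewrite adde0 !ext0_dotz.
  move=> ->.
  - rewrite (bigD1 k)//= eqxx big1 ?adde0// => k' /negbTE ->.
    rewrite /planar_law.
    have E : (\int[gam]_x \int[gam]_y (@cst (R * R) _ 0%E (((c k').1.1 * x)%R, ((c k').1.2 * x + (c k').2 * y)%R)) = \int[gam]_x \int[gam]_y 0)%E by [].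
    by rewrite E !gauss_integral_cst.
  - by move=> k'; case: ifP.
  - by move=> k' u; case: ifP.
exists c; split => //.
rewrite -[RHS](eq_bigr _ (fun k _ => esym (one k))) -(cE h (fun _ => 0))//.
by apply: eq_iter_gauss => w _; apply: eq_bigr => k _; rewrite !ext0_dotz.
Qed.

Lemma gauss_expect_sum : EE (fun z => \sum_k planar_fun (a k) (b k) (h k) z)%E =
  (\sum_k EE (planar_fun (a k) (b k) (h k)))%E.
Proof. by have [c []] := gauss_expect_planar_family. Qed.

End Family.

Lemma gauss_expect_planar a b h : measurable_fun setT h -> (forall u, 0 <= h u)%E ->
  exists c : R * R * R, 
  [/\ 0 <= c.1.1 /\ 0 <= c.2, c.1.1 ^+ 2 = \sum_(j < d) a j ^+ 2,
     c.1.1 * c.1.2 = \sum_(j < d) a j * b j &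
     c.1.2 ^+ 2 + c.2 ^+ 2 = \sum_(j < d) b j ^+ 2] /\
  EE (planar_fun a b h) = planar_law c.1.1 c.1.2 c.2 h.
Proof.
move=> mh h0.
have [c [cP cE _]] := @gauss_expect_planar_family unit (fun _ => a) (fun _ => b)
  (fun _ => h) (fun _ => mh) (fun _ => h0).
by exists (c tt); split => //; exact: planar_coef_ext0.
Qed.

Lemma gauss_expect_line (a : 'I_d -> R) (f : R -> R) : measurable_fun setT f ->
  (forall x, 0 <= f x) -> exists p : R, [/\ 0 <= p, p ^+ 2 = \sum_(j < d) a j ^+ 2 &
  EE (fun z => (f (dotz a z))%:E) = (\int[gam]_x (f (p * x)%R)%:E)%E].
Proof.
move=> mf f0.
have [||c [[[c0 _] c1 _ _] cE]] := @gauss_expect_planar a a (fun u => (f u.1)%:E).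
- by apply/measurable_EFinP; apply: (measurableT_comp mf); meas.
- by move=> u; rewrite lee_fin.
exists c.1.1; split => //; rewrite [LHS]cE.
by apply: eq_integral => x _; exact: (gauss_integral_cst (f (c.1.1 * x))%:E).
Qed.

Lemma gauss_expect_sqr_line (a : 'I_d -> R) (k : R) : 0 <= k ->
  EE (fun z => (k * dotz a z ^+ 2)%:E) = (k * \sum_(j < d) a j ^+ 2)%:E.
Proof.
move=> k0.
have [||p [p0 pa ->]] := @gauss_expect_line a (fun x => k * x ^+ 2); first by meas.
  by move=> x; rewrite mulr_ge0// sqr_ge0.
transitivity (\int[gam]_x ((k * p ^+ 2)%:E * (x ^+ 2)%:E))%E.
  by apply: eq_integral => x _; rewrite -EFinM; congr EFin; ring.
rewrite ge0_integralZl//; [|side..].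
by rewrite gauss_integral_sqr mule1 pa.
Qed.

(** [x^4 = 16 (x^2 / 4)^2 <= 64 expR (x^2 / 4)], and the integral of the exponential is at most
    2. *)
Lemma gauss_expect_pow4_line (a : 'I_d -> R) (k : R) : 0 <= k ->
  \sum_(j < d) a j ^+ 2 <= 1 ->
  (EE (fun z => (k * dotz a z ^+ 4)%:E) <= (128 * k)%:E)%E.
Proof.
move=> k0 a1.
have [||p [p0 pa ->]] := @gauss_expect_line a (fun x => k * x ^+ 4); first by meas.
  by move=> x; rewrite mulr_ge0// exprn_even_ge0.
have -> : 128 * k = 2 * (64 * k) by ring.
apply: gauss_integral_le_expR4; last by nonneg.
- by move=> x; rewrite mulr_ge0// exprn_even_ge0.
- move=> x; rewrite (mulrC 64) -mulrA; apply: ler_wpM2l => //.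
  have x4 : (x ^+ 2 / 4) ^+ 2 <= 4 * expR (x ^+ 2 / 4).
    by apply: sqr_le_expR; rewrite divr_ge0// sqr_ge0.
  have p1 : p ^+ 4 <= 1 by rewrite (exprM p 2 2) exprn_ile1 ?sqr_ge0// pa.
  have : (p * x) ^+ 4 <= x ^+ 4.
    by rewrite exprMn ler_piMl// exprn_even_ge0.
  have -> : x ^+ 4 = 16 * (x ^+ 2 / 4) ^+ 2 by field.
  lra.
Qed.

End Expectation.


(** * Variance of a weighted sum of [g] over correlated coordinates *)

Section QuadraticStatistic.
Variables (R : realType) (d : nat) (A : 'M[R]_d).
Variables (g : R -> R) (M t : R) (w : 'I_d -> R).
Local Notation gam := (normal_prob (0:R) 1).
Local Notation EE := (@gauss_expect R d).
Local Notation Sig := (A *m A^T).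
Local Notation m2 := (\int[gam]_x (g x ^+ 2)%:E)%E.
Local Notation eps i z := (dotz (fun j => A i j) z).
Local Notation sd i := (Num.sqrt (Sig i i)).
Hypotheses (mg : measurable_fun setT g) (g_even : forall x, g (- x) = g x)
  (g_mean : (\int[gam]_x (g x)%:E = 0)%E) (M0 : 0 <= M)
  (gM : forall x, `|g x| <= M * expR (x ^+ 2 / 16))
  (t0 : 0 <= t) (g_supp : forall x, `|x| < t -> g x = 0)
  (w0 : forall i, 0 <= w i <= Sig i i).

(** The argument of [g] is standardised; where [sd i = 0] the quotient is a default value, but [w0]
    forces [w i = 0]. *)
Definition stat_term i z : R := w i * g (eps i z / sd i).

Definition cov_const : R := 260 ^+ 2 * M ^+ 2 * expR (- (t ^+ 2) / 8).

Lemma cov_const_ge0 : 0 <= cov_const.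
Proof. by rewrite mulr_ge0 ?expR_ge0// mulr_ge0 ?sqr_ge0. Qed.

Lemma gramE i j : Sig i j = \sum_k A i k * A j k.
Proof. by rewrite mxE; apply: eq_bigr => k _; rewrite mxE. Qed.

Lemma gram_diag i : Sig i i = \sum_k A i k ^+ 2.
Proof. by rewrite gramE; apply: eq_bigr => k _; rewrite expr2. Qed.

Lemma gram_diag_ge0 i : 0 <= Sig i i.
Proof. by rewrite gram_diag; apply: sumr_ge0 => k _; exact: sqr_ge0. Qed.

Lemma sd_sqr i : sd i ^+ 2 = Sig i i.
Proof. by rewrite sqr_sqrtr// gram_diag_ge0. Qed.

Lemma measurable_scaled_g (b : R) : measurable_fun setT (fun x : R => g (x / b)).
Proof. by apply: (measurableT_comp mg); meas. Qed.

Lemma m2_fin : exists2 m : R, 0 <= m & m2 = m%:E.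
Proof.
have m20 : (0 <= m2)%E by apply: integral_ge0 => x _; rewrite lee_fin sqr_ge0.
have m2f : m2 \is a fin_num.
  by rewrite ge0_fin_numE//; apply: le_lt_trans (g_m2_le M0 gM t0 g_supp) (ltry _).
by exists (fine m2); rewrite ?fineK// -lee_fin fineK.
Qed.

(** The correlation is [q / b], and [al <= p^2], [be <= b^2] give [al be (q / b)^2 <= (p q)^2], the
    squared covariance. If a standard deviation vanishes so does its weight; when [b = 0] the
    correlation is taken to be 0. *)
Lemma planar_pair_le (al be p q r b : R) : 0 <= p -> 0 <= r -> 0 <= b ->
  q ^+ 2 + r ^+ 2 = b ^+ 2 -> 0 <= al <= p ^+ 2 -> 0 <= be <= b ^+ 2 ->
  (planar_law p q r (fun u => ((al * g (u.1 / p) + be * g (u.2 / b)) ^+ 2)%:E)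
   <= (al ^+ 2)%:E * m2 + (be ^+ 2)%:E * m2 + (2 * cov_const * (p * q) ^+ 2)%:E)%E.
Proof.
move=> p0 r0 b0 qrb /andP[al0 alp] /andP[be0 beb].
have C0 := cov_const_ge0.
have E (p' q' r' : R) : 0 <= r' -> q' ^+ 2 + r' ^+ 2 = 1 -> 
   (forall x, al * g (p * x / p) = al * g x) ->
   (forall x y, be * g ((q * x + r * y) / b) = be * g (q' * x + r' * y)) ->
   al * be * (260 ^+ 2 * M ^+ 2 * q' ^+ 2 * expR (- t ^+ 2 / 8)) <= cov_const * (p * q) ^+ 2 ->
  (planar_law p q r (fun u => ((al * g (u.1 / p) + be * g (u.2 / b)) ^+ 2)%:E)
   <= (al ^+ 2)%:E * m2 + (be ^+ 2)%:E * m2 + (2 * cov_const * (p * q) ^+ 2)%:E)%E.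
  move=> r'0 qr' h1 h2 h3; rewrite /planar_law/=.
  have -> : (\int[gam]_x \int[gam]_y ((al * g (p * x / p) + be * g ((q * x + r * y) / b)) ^+ 2)%:E
    = \int[gam]_x \int[gam]_y ((al * g x + be * g (q' * x + r' * y)) ^+ 2)%:E)%E.
    by apply: eq_integral => x _; apply: eq_integral => y _; rewrite h1 h2.
  have [rho|rho] := leP `|q'| (1 / 64).
    have r'p : 0 < r'.
      rewrite lt_def r'0 andbT; apply/eqP => r'E.
      have : q' ^+ 2 <= (1 / 64) ^+ 2.
        rewrite -[leLHS]real_normK ?num_real//; apply: lerXn2r => //; rewrite nnegrE; lra.
      by rewrite r'E in qr'; lra.
    apply: (le_trans (pair_cov_small mg g_even g_mean M0 gM t0 g_supp rho r'p qr' al0 be0)).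
    by apply: leeD => //; rewrite lee_fin; lra.
  apply: (le_trans (pair_cov_large mg M0 gM t0 g_supp (ltW rho) r'0 qr' al0 be0)).
  by apply: leeD => //; rewrite lee_fin; lra.
have [pE|pn] := eqVneq p 0.
  have alE : al = 0 by rewrite pE expr0n/= in alp; lra.
  have [bE|bn] := eqVneq b 0.
    have beE : be = 0 by rewrite bE expr0n/= in beb; lra.
    apply: (E 0 0 1) => //.
    + by rewrite expr0n expr1n add0r.
    + by move=> x; rewrite alE !mul0r.
    + by move=> x y; rewrite beE !mul0r.
    + by rewrite alE !mul0r mulr_ge0 ?sqr_ge0.
  apply: (E 0 (q / b) (r / b)) => //.
  + by rewrite divr_ge0.
  + by rewrite !exprMn -mulrDl qrb -exprMn divff// expr1n.
  + by move=> x; rewrite alE !mul0r.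
  + by move=> x y; congr (_ * g _); field.
  + by rewrite alE !mul0r mulr_ge0 ?sqr_ge0.
have gx x : al * g (p * x / p) = al * g x by congr (_ * g _); field.
have [bE|bn] := eqVneq b 0.
  have beE : be = 0 by rewrite bE expr0n/= in beb; lra.
  apply: (E 0 0 1) => //.
  + by rewrite expr0n expr1n add0r.
  + by move=> x y; rewrite beE !mul0r.
  + by rewrite beE mulr0 !mul0r mulr_ge0 ?sqr_ge0.
apply: (E 0 (q / b) (r / b)) => //.
+ by rewrite divr_ge0.
+ by rewrite !exprMn -mulrDl qrb -exprMn divff// expr1n.
+ by move=> x y; congr (_ * g _); field.
have -> : al * be * (260 ^+ 2 * M ^+ 2 * (q / b) ^+ 2 * expR (- t ^+ 2 / 8)) =
  cov_const * ((al * be) * (q / b) ^+ 2) by rewrite /cov_const; ring.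
apply: ler_wpM2l => //.
have -> : (p * q) ^+ 2 = (p ^+ 2 * b ^+ 2) * (q / b) ^+ 2 by field.
by apply: ler_wpM2r; [exact: sqr_ge0|exact: ler_pM].
Qed.

Lemma stat_pairE i j z : ((stat_term i z + stat_term j z) ^+ 2)%:E =
  planar_fun (fun k => A i k) (fun k => A j k)
    (fun u => ((w i * g (u.1 / sd i) + w j * g (u.2 / sd j)) ^+ 2)%:E) z.
Proof. by []. Qed.

Lemma measurable_pair_fun i j (k : R) : measurable_fun setT (fun u : R * R =>
  (k * (w i * g (u.1 / sd i) + w j * g (u.2 / sd j)) ^+ 2)%:E).
Proof.
apply/measurable_EFinP; apply: measurable_funM; first exact: measurable_cst.
apply: measurable_funX; apply: measurable_funD; apply: measurable_funM;
  try exact: measurable_cst.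
- by apply: (measurableT_comp mg); meas.
- by apply: (measurableT_comp mg); meas.
Qed.

Lemma expect_stat_pair (k : R) i j : 0 <= k ->
  (EE (fun z => (k * (stat_term i z + stat_term j z) ^+ 2)%:E)
   <= k%:E * ((w i ^+ 2)%:E * m2 + (w j ^+ 2)%:E * m2 + (2 * cov_const * Sig i j ^+ 2)%:E))%E.
Proof.
move=> k0.
have h0 (u : R * R) : (0 <= (k * (w i * g (u.1 / sd i) + w j * g (u.2 / sd j)) ^+ 2)%:E)%E.
  by rewrite lee_fin mulr_ge0// sqr_ge0.
have [c [[[p0 r0] pE pqE qrE] cE]] := @gauss_expect_planar R d (fun k => A i k)
  (fun k => A j k) _ (measurable_pair_fun i j k) h0.
rewrite [leLHS]cE.
move: p0 r0 pE pqE qrE; move: (c.1.1) (c.1.2) (c.2) => p q r p0 r0 pE pqE qrE.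
have pS : p = sd i by rewrite gram_diag -pE sqrtr_sqr ger0_norm.
rewrite (gramE i j) -pqE -pS.
have -> : planar_law p q r (fun u => (k * (w i * g (u.1 / p) + w j * g (u.2 / sd j)) ^+ 2)%:E)
  = (k%:E * planar_law p q r (fun u => ((w i * g (u.1 / p) + w j * g (u.2 / sd j)) ^+ 2)%:E))%E.
  have mF : measurable_fun setT (fun v : R * R => ((w i * g (p * v.1 / p) + w j * g ((q * v.1 + r * v.2) / sd j)) ^+ 2)%:E).
    apply/measurable_EFinP.
    apply: measurable_funX; apply: measurable_funD; apply: measurable_funM;
      try exact: measurable_cst.
    - by apply: (measurableT_comp mg); meas.
    - by apply: (measurableT_comp mg); meas.
  have F0 (v : R * R) : (0 <= ((w i * g (p * v.1 / p) + w j * g ((q * v.1 + r * v.2) / sd j)) ^+ 2)%:E)%E.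
    by rewrite lee_fin sqr_ge0.
  have mF1 := @measurable_fun_fubini_tonelli_F _ _ _ _ _ gam _ mF F0.
  rewrite /planar_law -ge0_integralZl//; [|first [exact: mF1
    | by move=> x _; apply: integral_ge0 => y _; rewrite lee_fin sqr_ge0]..].
  apply: eq_integral => x _; rewrite -ge0_integralZl//.
    have mp : measurable_fun setT (fun y : R => (x : R, y)) by meas.
    exact: (measurableT_comp mF mp).
  by move=> y _; rewrite lee_fin sqr_ge0.
apply: lee_wpmul2l; first by rewrite lee_fin.
apply: planar_pair_le => //.
- by rewrite sd_sqr gram_diag.
- by rewrite pE -gram_diag.
- by rewrite sd_sqr.
Qed.

Lemma expect_stat_sqr (k : R) i : 0 <= k ->
  EE (fun z => (k * stat_term i z ^+ 2)%:E) = (k%:E * ((w i ^+ 2)%:E * m2))%E.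
Proof.
move=> k0.
have mf : measurable_fun setT (fun x : R => k * (w i * g (x / sd i)) ^+ 2).
  apply: measurable_funM; first exact: measurable_cst.
  apply: measurable_funX; apply: measurable_funM; first exact: measurable_cst.
  exact: measurable_scaled_g.
have [|p [p0 pE ->]] := @gauss_expect_line R d (fun k => A i k) _ mf.
  by move=> x; rewrite mulr_ge0// sqr_ge0.
have pS : p = sd i by rewrite gram_diag -pE sqrtr_sqr ger0_norm.
rewrite muleA -EFinM -ge0_integralZl//; [|side..].
apply: eq_integral => x _; rewrite -EFinM -pS; congr EFin.
have [pz|pn] := eqVneq p 0.
  have -> : w i = 0.
    have /andP[a0 a1] := w0 i; have := pE; rewrite pz -gram_diag expr0n/= => a2.
    by apply/eqP; rewrite eq_le a0 andbT; apply: (le_trans a1); rewrite -a2.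
  by ring.
have -> : p * x / p = x by field.
ring.
Qed.

(* [(sum X_i)^2 + d sum X_i^2 = 1/2 sum (X_i + X_j)^2] only involves
   nonnegative functions of at most two Gaussian variables. *)
Lemma sqr_sum_pairs (X : 'I_d -> R) :
  (\sum_i X i) ^+ 2 + d%:R * \sum_i X i ^+ 2 = \sum_i \sum_j 1 / 2 * (X i + X j) ^+ 2.
Proof.
transitivity (\sum_i \sum_j (X i * X j + (1 / 2 * X i ^+ 2 + 1 / 2 * X j ^+ 2))); last first.
  by apply: eq_bigr => i _; apply: eq_bigr => j _; field.
under [RHS]eq_bigr do rewrite big_split/= big_split/=.
rewrite big_split/= big_split/= expr2 big_distrlr/=; congr (_ + _).
under [X in _ = X + _]eq_bigr do rewrite sumr_const card_ord -(mulr_natl _ d).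
rewrite sumr_const card_ord -[X in _ = _ + X](mulr_natl _ d) -!mulr_sumr.
by field.
Qed.

(** One index type for the four kinds of summand (square of a form, constant, fourth powers, pairs),
    so that one use of [gauss_expect_sum] splits the whole bound. *)
Definition term_kind : finType := ('I_1 + 'I_1 + 'I_d + 'I_d * 'I_d)%type.

(** Adding [c2 d sum_i stat_term^2] to both sides makes the right-hand side a sum of nonnegative
    functions of at most two linear forms, by [sqr_sum_pairs]. Superadditivity then separates [f]
    from the added term, whose expectation is finite and known exactly. It cancels against the
    diagonal parts of the pair bounds, and only the covariances, at most [cov_const * Sig i j ^ 2]
    each, survive. *)
Lemma expect_le_quadratic (f : (nat -> R) -> R) (v c : 'I_d -> R) (c0 k c2 : R) :
  0 <= c0 -> 0 <= k -> 0 <= c2 -> (forall i, 0 <= c i) -> (forall i, Sig i i <= 1) ->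
  (forall z, 0 <= f z) ->
  (forall z, f z <= c0 * dotz v z ^+ 2 + k + \sum_i c i * eps i z ^+ 4
     + c2 * (\sum_i stat_term i z) ^+ 2) ->
  (EE (fun z => (f z)%:E) <= (c0 * \sum_j v j ^+ 2 + k + 128 * \sum_i c i
     + c2 * cov_const * \sum_i \sum_j Sig i j ^+ 2)%:E)%E.
Proof.
move=> c00 k0 c20 c_ge0 Sig1 f0 fle.
pose la (x : term_kind) : 'I_d -> R := match x with
  | inl (inl (inl _)) => v | inl (inl (inr _)) => v
  | inl (inr i) => fun j => A i j | inr (i, _) => fun j => A i j end.
pose lb (x : term_kind) : 'I_d -> R := match x with
  | inl (inl (inl _)) => v | inl (inl (inr _)) => v
  | inl (inr i) => fun j => A i j | inr (_, j) => fun k => A j k end.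
pose h (x : term_kind) (u : R * R) : \bar R := match x with
  | inl (inl (inl _)) => (c0 * u.1 ^+ 2)%:E
  | inl (inl (inr _)) => k%:E
  | inl (inr i) => (c i * u.1 ^+ 4)%:E
  | inr (i, j) => (c2 * (1 / 2) * (w i * g (u.1 / sd i) + w j * g (u.2 / sd j)) ^+ 2)%:E end.
have c2h : 0 <= c2 * (1 / 2) by rewrite mulr_ge0//; lra.
have mh x : measurable_fun setT (h x).
  case: x => [[[?|?]|i]|[i j]]; rewrite /h; [by meas|by meas|by meas|].
  exact: measurable_pair_fun.
have h0 x u : (0 <= h x u)%E.
  case: x => [[[?|?]|i]|[i j]]; rewrite /h lee_fin// mulr_ge0 ?sqr_ge0//.
  by rewrite exprn_even_ge0.
(* The compensating term added to both sides. *)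
pose G z := (\sum_i (c2 * d%:R * stat_term i z ^+ 2)%:E)%E.
have cd0 : 0 <= c2 * d%:R by rewrite mulr_ge0.
have EG : EE G = (\sum_i (c2 * d%:R)%:E * ((w i ^+ 2)%:E * m2))%E.
  rewrite -(eq_bigr _ (fun i _ => expect_stat_sqr i cd0)).
  apply: (@gauss_expect_sum R d 'I_d (fun i j => A i j) (fun i j => A i j)
    (fun i u => (c2 * d%:R * (w i * g (u.1 / sd i)) ^+ 2)%:E)).
  - move=> i; apply/measurable_EFinP; apply: measurable_funM; first exact: measurable_cst.
    apply: measurable_funX; apply: measurable_funM; first exact: measurable_cst.
    by apply: (measurableT_comp mg); meas.
  - by move=> i u; rewrite lee_fin mulr_ge0 ?sqr_ge0.
have EH := gauss_expect_sum la lb mh h0.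
have le1 : (EE (fun z => (f z)%:E) + EE G <= \sum_x EE (planar_fun (la x) (lb x) (h x)))%E.
  rewrite -EH; apply: le_trans (iter_gauss_superadd _ _ _ _) _.
  - by move=> z; rewrite lee_fin.
  - by move=> z; apply: sume_ge0 => i _; rewrite lee_fin mulr_ge0 ?sqr_ge0.
  apply: le_iter_gauss => z.
    apply: adde_ge0; first by rewrite lee_fin.
    by apply: sume_ge0 => i _; rewrite lee_fin mulr_ge0 ?sqr_ge0.
  rewrite !big_sumType/= !big_ord1 /planar_fun /=.
  rewrite [X in (_ <= _ + X)%E](_ : _ = \sum_i \sum_j
    (c2 * (1 / 2) * (stat_term i z + stat_term j z) ^+ 2)%:E)%E; last first.
    by rewrite pair_bigA; apply: eq_bigr => -[i j] _.
  rewrite /G !sumEFin; under [X in (_ <= _ + X)%E]eq_bigr do rewrite sumEFin.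
  rewrite sumEFin -!EFinD lee_fin.
  have := sqr_sum_pairs (stat_term^~ z) => E.
  have := fle z.
  have -> : \sum_(i < d) \sum_(j < d) c2 * (1 / 2) * (stat_term i z + stat_term j z) ^+ 2 =
     c2 * \sum_(i < d) \sum_(j < d) 1 / 2 * (stat_term i z + stat_term j z) ^+ 2.
    rewrite mulr_sumr; apply: eq_bigr => i _; rewrite mulr_sumr; apply: eq_bigr => j _.
    by ring.
  rewrite -E -mulr_sumr mulrDr mulrA; lra.
have [m m0 mE] := m2_fin.
rewrite EG mE in le1.
have le2 : (\sum_x EE (planar_fun (la x) (lb x) (h x)) <=
   (c0 * \sum_j v j ^+ 2 + k + 128 * \sum_i c i)%:E +
   \sum_(ij : 'I_d * 'I_d) (c2 * (1 / 2) * (w ij.1 ^+ 2 * m + w ij.2 ^+ 2 * m + 2 * cov_const * Sig ij.1 ij.2 ^+ 2))%:E)%E.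
  rewrite !big_sumType/= !big_ord1 !EFinD; apply: leeD; last first.
    apply: lee_sum => -[i j] _; have := expect_stat_pair i j c2h.
    by rewrite mE -!EFinM.
  apply: leeD; first apply: leeD.
  - by have := gauss_expect_sqr_line v c00 => <-.
  - have := @gauss_expect_line R d v (fun=> k) (@measurable_cst _ _ _ _ _ k) (fun=> k0).
    by case=> p [_ _]; rewrite gauss_integral_cst => <-.
  - rewrite mulr_sumr -sumEFin; apply: lee_sum => i _.
    by apply: (gauss_expect_pow4_line (c_ge0 i)); rewrite -gram_diag.
have := le_trans le1 le2.
rewrite !sumEFin -EFinD.
have -> : \sum_i c2 * d%:R * (w i ^+ 2 * m) = c2 * d%:R * m * \sum_i w i ^+ 2.
  by rewrite mulr_sumr; apply: eq_bigr => i _; ring.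
(* The expectation of [G] moves to the right; the terms in [m] then cancel. *)
rewrite -leeBrDr// -EFinB; move/le_trans; apply; rewrite lee_fin.
rewrite -(pair_bigA _ (fun i j => c2 * (1 / 2) * (w i ^+ 2 * m + w j ^+ 2 * m + 2 * cov_const * Sig i j ^+ 2)))/=.
have -> : \sum_(i < d) \sum_(j < d) c2 * (1 / 2) * (w i ^+ 2 * m + w j ^+ 2 * m + 2 * cov_const * Sig i j ^+ 2)
  = c2 * (1 / 2) * (d%:R * m * (\sum_i w i ^+ 2) + d%:R * m * (\sum_i w i ^+ 2) + 2 * cov_const * \sum_i \sum_j Sig i j ^+ 2).
  under eq_bigr do rewrite -mulr_sumr big_split/= big_split/= sumr_const card_ord -(mulr_natl _ d).
  rewrite -mulr_sumr; congr (_ * _); rewrite big_split/= big_split/=; congr (_ + _ + _).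
  - by rewrite mulr_sumr; apply: eq_bigr => i _; ring.
  - by rewrite sumr_const card_ord -(mulr_natl _ d) -mulr_suml; ring.
  - by rewrite mulr_sumr; apply: eq_bigr => i _; rewrite mulr_sumr.
lra.
Qed.

End QuadraticStatistic.


(** * Bounds on the variance of the linear term *)

Section QuadraticForms.
Variables (R : realType) (d : nat) (A : 'M[R]_d).
Local Notation Sig := (A *m A^T).

(** The variance of [sum_i theta i * eps i], that is [theta^T Sig theta]; this form is the squared
    norm of its coefficients in [z]. *)
Definition signal_var (theta : 'I_d -> R) : R := \sum_j (\sum_i theta i * A i j) ^+ 2.

Lemma signal_varE theta :
  signal_var theta = \sum_i \sum_j theta i * Sig i j * theta j.
Proof.
rewrite /signal_var.
transitivity (\sum_k \sum_i \sum_j theta i * (A i k * A j k) * theta j).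
  apply: eq_bigr => k _; rewrite expr2 big_distrlr/=.
  by apply: eq_bigr => i _; apply: eq_bigr => j _; ring.
rewrite exchange_big; apply: eq_bigr => i _.
rewrite exchange_big; apply: eq_bigr => j _.
by rewrite gramE mulr_sumr mulr_suml.
Qed.

Lemma signal_var_ge0 theta : 0 <= signal_var theta.
Proof. by apply: sumr_ge0 => j _; exact: sqr_ge0. Qed.

Lemma sqnorm_ge0 (theta : 'I_d -> R) : 0 <= sqnorm theta.
Proof. by apply: sumr_ge0 => j _; exact: sqr_ge0. Qed.

Lemma frob_sqr (S : 'M[R]_d) : frob S ^+ 2 = \sum_i \sum_j S i j ^+ 2.
Proof.
by rewrite sqr_sqrtr//; apply: sumr_ge0 => i _; apply: sumr_ge0 => j _; exact: sqr_ge0.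
Qed.

Lemma signal_var_le_frob theta : signal_var theta <= frob Sig * sqnorm theta.
Proof.
rewrite -(@ler_pXn2r _ 2) ?nnegrE ?signal_var_ge0 ?mulr_ge0 ?sqrtr_ge0 ?sqnorm_ge0//.
have := sqr_sum_le xpredT (fun p : 'I_d * 'I_d => Sig p.1 p.2) (fun p => theta p.1 * theta p.2).
rewrite -(pair_bigA _ (fun i j => Sig i j * (theta i * theta j))).
rewrite -(pair_bigA _ (fun i j => Sig i j ^+ 2)).
rewrite -(pair_bigA _ (fun i j => (theta i * theta j) ^+ 2))/=.
rewrite exprMn frob_sqr signal_varE.
have -> : \sum_i \sum_j theta i * Sig i j * theta j = \sum_i \sum_j Sig i j * (theta i * theta j).
  by apply: eq_bigr => i _; apply: eq_bigr => j _; ring.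
have -> // : \sum_i \sum_j (theta i * theta j) ^+ 2 = sqnorm theta ^+ 2.
rewrite expr2 /sqnorm big_distrlr/=.
by apply: eq_bigr => i _; apply: eq_bigr => j _; rewrite exprMn.
Qed.

Lemma sqnorm_supp (theta : 'I_d -> R) : sqnorm theta = \sum_(i in theta_supp theta) theta i ^+ 2.
Proof.
rewrite [RHS]big_mkcond; apply: eq_bigr => i _; rewrite inE.
by case: eqP => //= ->; rewrite expr0n.
Qed.

(** Cauchy-Schwarz over the support in each column of [A] leaves the trace of [Sig] on the support,
    a sum of at most [s] entries bounded by 1. *)
Lemma signal_var_le_sparsity s theta : (forall i, Sig i i <= 1) -> in_B0 s theta ->
  signal_var theta <= s%:R * sqnorm theta.
Proof.
move=> Sig1 th.
apply: (@le_trans _ _ (\sum_j sqnorm theta * \sum_(i in theta_supp theta) A i j ^+ 2)).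
  apply: ler_sum => j _; rewrite sqnorm_supp.
  have -> : \sum_i theta i * A i j = \sum_(i in theta_supp theta) theta i * A i j.
    rewrite [RHS]big_mkcond; apply: eq_bigr => i _; rewrite inE.
    by case: eqP => //= ->; rewrite mul0r.
  exact: sqr_sum_le.
rewrite -mulr_sumr mulrC; apply: ler_wpM2r; first exact: sqnorm_ge0.
rewrite exchange_big/=.
apply: (@le_trans _ _ (\sum_(i in theta_supp theta) 1)).
  by apply: ler_sum => i _; rewrite -gram_diag.
by rewrite sumr_const ler_nat.
Qed.

Lemma gram_tr : Sig^T = Sig.
Proof. by rewrite trmx_mul trmxK. Qed.

Lemma signal_var_le_lambda theta : signal_var theta <= lambda_max Sig * sqnorm theta.
Proof.
have := bilform_le_lambda_max (\row_i theta i) gram_tr.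
have -> : sqr_rv (\row_i theta i) = sqnorm theta.
  by apply: eq_bigr => i _; rewrite mxE.
rewrite bilformE signal_varE.
have -> // : \sum_i \sum_j (\row_i theta i) ord0 i * Sig i j * (\row_i theta i) ord0 j =
  \sum_i \sum_j theta i * Sig i j * theta j.
by apply: eq_bigr => i _; apply: eq_bigr => j _; rewrite !mxE.
Qed.

Lemma lambda_max_gram_ge0 : (0 < d)%N -> 0 <= lambda_max Sig.
Proof.
move=> d0; pose e (i : 'I_d) : R := (i == Ordinal d0)%:R.
have e1 : sqnorm e = 1.
  rewrite /sqnorm (bigD1 (Ordinal d0))//= /e eqxx expr1n big1 ?addr0//.
  by move=> i /negbTE ->; rewrite expr0n.
by have := signal_var_le_lambda e; rewrite e1 mulr1; apply: le_trans (signal_var_ge0 _).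
Qed.

Lemma signal_var_le_lambda_supp theta : signal_var theta <=
  sqnorm theta * lambda_max (principal_submx Sig (theta_supp theta)).
Proof.
set S := theta_supp theta; set P := principal_submx Sig S.
have PT : P^T = P.
  apply/matrixP => i j; rewrite [LHS]mxE [LHS]mxE [RHS]mxE !gramE.
  by apply: eq_bigr => k _; rewrite mulrC.
have := bilform_le_lambda_max (\row_k theta (enum_val k)) PT.
have -> : sqr_rv (\row_k theta (enum_val (A:=mem S) k)) = sqnorm theta.
  rewrite sqnorm_supp big_enum_val; apply: eq_bigr => i _; by rewrite mxE.
rewrite bilformE signal_varE mulrC.
have -> // : \sum_i \sum_j theta i * Sig i j * theta j =
  \sum_k \sum_l (\row_k theta (enum_val (A:=mem S) k)) ord0 k * P k l * (\row_k theta (enum_val k)) ord0 l.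
transitivity (\sum_(i in S) \sum_(j in S) theta i * Sig i j * theta j).
  rewrite [RHS]big_mkcond; apply: eq_bigr => i _; rewrite inE.
  case: eqP => /= [->|_]; first by rewrite big1// => j _; rewrite !mul0r.
  rewrite [RHS]big_mkcond; apply: eq_bigr => j _; rewrite inE.
  by case: eqP => //= ->; rewrite mulr0.
rewrite big_enum_val; apply: eq_bigr => k _.
by rewrite big_enum_val; apply: eq_bigr => l _; rewrite !mxE.
Qed.

End QuadraticForms.


(** * Risk in the dense and in the sparse regime *)

Section RiskBound.
Variables (R : realType) (d s : nat) (sigma : R) (A : 'M[R]_d) (theta : 'I_d -> R).
Local Notation gam := (normal_prob (0:R) 1).
Local Notation EE := (@gauss_expect R d).
Local Notation Sig := (A *m A^T).
Local Notation eps i z := (dotz (fun j => A i j) z).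
Local Notation sd i := (Num.sqrt (Sig i i)).
Local Notation F := (frob Sig).
Local Notation dev z := (Qhat s sigma Sig (Yobs theta sigma A z) - sqnorm theta).

Lemma eps_eq0 i z : Sig i i = 0 -> eps i z = 0.
Proof.
rewrite gram_diag => /eqP; rewrite psumr_eq0; last by move=> k _; exact: sqr_ge0.
move/allP => h; rewrite /dotz big1// => k _.
by have := h k (mem_index_enum k); rewrite sqrf_eq0 => /eqP ->; rewrite mul0r.
Qed.

Lemma dot_signal z : dotz (fun j => \sum_i theta i * A i j) z = \sum_i theta i * eps i z.
Proof.
rewrite /dotz; under eq_bigr do rewrite mulr_suml.
rewrite exchange_big; apply: eq_bigr => i _; rewrite mulr_sumr.
by apply: eq_bigr => j _; rewrite mulrA.
Qed.

Hypotheses (sigma0 : 0 < sigma) (Sig1 : forall i, Sig i i <= 1).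

(** Apply [expect_le_quadratic] with [g x = x^2 - 1], [t = 0] and [w i = Sig i i]. Stating it for
    any [f] below [kap * dev^2 + kap'] lets the same bound serve both [Qhat] and [Nhat]. *)
Lemma dense_risk (kap kap' : R) (f : (nat -> R) -> R) : 0 <= kap -> 0 <= kap' ->
  F < s%:R -> (forall z, 0 <= f z) -> (forall z, f z <= kap * dev z ^+ 2 + kap') ->
  (EE (fun z => (f z)%:E) <= (kap * (8 * (sigma ^+ 2 * signal_var A theta)
    + 2 * (260 ^+ 2 * 16 ^+ 2) * (sigma ^+ 4 * F ^+ 2)) + kap')%:E)%E.
Proof.
move=> k0 k'0 Fs f0 fle.
pose g (x : R) := x ^+ 2 - 1.
have mg : measurable_fun setT g by rewrite /g; meas.
have ge x : g (- x) = g x by rewrite /g sqrrN.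
have M0 : (0 : R) <= 16 by [].
have gM x : `|g x| <= 16 * expR (x ^+ 2 / 16).
  have h := expR_ge1Dx (x ^+ 2 / 16); have x2 := sqr_ge0 x.
  rewrite /g ler_norml; apply/andP; split; lra.
have t0 : (0 : R) <= 0 by [].
have gs x : `|x| < 0 -> g x = 0 by rewrite normr_lt0.
have gm : (\int[gam]_x (g x)%:E = 0)%E.
  have i1 : gam.-integrable setT (EFin \o (fun x : R => x ^+ 2)).
    apply: (@gauss_integrable_le_expR4 R _ 4); first by meas.
    move=> x; rewrite ger0_norm ?sqr_ge0//; have := le_expR (x ^+ 2 / 4); lra.
  have i2 : gam.-integrable setT (EFin \o (fun x : R => 1)).
    apply: (@gauss_integrable_le_expR4 R _ 1); first by meas.
    move=> x; rewrite normr1 mul1r; have := expR_ge1Dx (x ^+ 2 / 4).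
    have := sqr_ge0 x; lra.
  have -> : (\int[gam]_x (g x)%:E = \int[gam]_x ((x ^+ 2)%:E - 1%:E))%E.
    by apply: eq_integral => x _; rewrite -EFinB.
  rewrite integralB// gauss_integral_sqr.
  by rewrite (gauss_integral_cst 1%:E) subee.
have w0 i : 0 <= Sig i i <= Sig i i by rewrite gram_diag_ge0 lexx.
have s2 := sqr_ge0 sigma.
have := @expect_le_quadratic R d A g 16 0 (fun i => Sig i i) mg ge gm M0 gM t0 gs w0
  f (fun j => \sum_i theta i * A i j) (fun=> 0) (kap * (8 * sigma ^+ 2)) kap' (kap * (2 * sigma ^+ 4)).
have c0 : 0 <= kap * (8 * sigma ^+ 2) by nonneg.
have s4 : 0 <= sigma ^+ 4 by rewrite exprn_even_ge0.
have c2 : 0 <= kap * (2 * sigma ^+ 4) by nonneg.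
move=> /(_ c0 k'0 c2 (fun=> lexx 0) Sig1 f0) h.
have {}h : (EE (fun z => (f z)%:E) <= (kap * (8 * sigma ^+ 2) * signal_var A theta + kap' + 128 * \sum_(i < d) 0 +
   kap * (2 * sigma ^+ 4) * cov_const 16 0 * \sum_(i < d) \sum_(j < d) Sig i j ^+ 2)%:E)%E.
  apply: h => z; apply: (le_trans (fle z)).
  rewrite [X in _ + X + _]big1; last by move=> i _; rewrite mul0r.
  rewrite dot_signal.
  have -> : \sum_(i < d) stat_term A g (fun i => Sig i i) i z = \sum_i (eps i z ^+ 2 - Sig i i).
    apply: eq_bigr => i _; rewrite /stat_term /g.
    have [S0|S0] := eqVneq (Sig i i) 0; first by rewrite S0 mul0r eps_eq0// expr0n subrr.
    by rewrite exprMn exprVn sd_sqr mulrBr mulr1 mulrCA divff// mulr1.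
  have -> : dev z = 2 * sigma * \sum_i theta i * eps i z + sigma ^+ 2 * \sum_i (eps i z ^+ 2 - Sig i i).
    rewrite /Qhat leNgt Fs/= /sqnorm -sumrB !mulr_sumr -big_split/=.
    by apply: eq_bigr => i _; rewrite /Yobs -/(eps i z); ring.
  set a := \sum_i theta i * eps i z; set b := \sum_i (_ - _).
  have : (2 * sigma * a + sigma ^+ 2 * b) ^+ 2 <= 8 * sigma ^+ 2 * a ^+ 2 + 2 * sigma ^+ 4 * b ^+ 2.
    have := sqr_ge0 (2 * sigma * a - sigma ^+ 2 * b); lra.
  move/(ler_wpM2l k0); lra.
apply: (le_trans h); rewrite lee_fin big1// mulr0 addr0 -frob_sqr /cov_const.
rewrite expr0n/= oppr0 mul0r expR0 mulr1.
move: (260 ^+ 2 * 16 ^+ 2) => cc; lra.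
Qed.

Section Sparse.
Hypotheses (s0 : (0 < s)%N) (sF : s%:R <= F) (th : in_B0 s theta).
Local Notation L := (ln (1 + F ^+ 2 / s%:R ^+ 2)).
Local Notation t := (tau s Sig).
Local Notation b := (beta t).

Let sR : 1 <= s%:R :> R. Proof. by rewrite ler1n. Qed.

Lemma ratio_ge1 : 1 <= F ^+ 2 / s%:R ^+ 2.
Proof.
have sR' := sR; rewrite ler_pdivlMr ?exprn_gt0//; last lra.
by rewrite mul1r; apply: lerXn2r => //; rewrite nnegrE ?ler0n ?sqrtr_ge0.
Qed.

(** [L >= ln 2]. A positive lower bound makes [tau >= 1] and lets terms of order [s^2] be absorbed
    into [(s L)^2]. *)
Lemma log_ratio_ge : 1 / 2 <= L.
Proof.
have r1 := ratio_ge1.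
have e1 : expR (1 / 2) <= (1 + F ^+ 2 / s%:R ^+ 2 : R).
  have h1 := expR_ge1Dx (- (1 / 2) : R).
  have h2 : expR (1 / 2) * expR (- (1 / 2)) = 1 :> R by rewrite -expRD subrr expR0.
  have h3 := expR_gt0 (1 / 2 : R); nra.
rewrite -[leLHS]expRK ler_ln//; rewrite posrE ?expR_gt0//; lra.
Qed.

Lemma tau_sqr : t ^+ 2 = 9 * L.
Proof.
have l := log_ratio_ge.
rewrite /tau exprMn sqr_sqrtr; [ring|lra].
Qed.

Lemma tau_ge1 : 1 <= t.
Proof.
have l := log_ratio_ge; have t2 := tau_sqr.
have t0 : 0 <= t by rewrite /tau mulr_ge0 ?sqrtr_ge0.
have [//|t1] := leP 1 t; exfalso.
have : t ^+ 2 <= 1 by rewrite exprn_ile1// ltW.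
lra.
Qed.

(** This is where the factor 3 in [tau] is spent: [tau^2 / 8 = 9 L / 8 >= L], and [expR (- L)] is
    the inverse of [1 + F^2 / s^2]. *)
Lemma tail_const_le : expR (- (t ^+ 2) / 8) * F ^+ 2 <= s%:R ^+ 2.
Proof.
have l := log_ratio_ge; have r1 := ratio_ge1; have sR' := sR.
have s2 : 0 < s%:R ^+ 2 :> R by rewrite exprn_gt0//; lra.
have F2 := sqr_ge0 F.
have e1 : expR (- (t ^+ 2) / 8) <= expR (- L) by rewrite ler_expR tau_sqr; lra.
apply: (@le_trans _ _ (expR (- L) * F ^+ 2)); first exact: ler_wpM2r.
rewrite expRN lnK; last by rewrite posrE; lra.
rewrite mulrC ler_pdivrMr; last lra.
by rewrite mulrDr mulr1 mulrCA divff ?lt0r_neq0// mulr1 lerDr ltW.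
Qed.

Lemma threshold_termE i z : theta i = 0 ->
  (Yobs theta sigma A z i ^+ 2 - sigma ^+ 2 * Sig i i * b)
    * (if sigma * sd i * t < `|Yobs theta sigma A z i| then 1 else 0) =
  sigma ^+ 2 * (Sig i i * threshold_fun t b (eps i z / sd i)).
Proof.
move=> thi; rewrite /Yobs thi add0r -/(eps i z).
have [S0|S0] := eqVneq (Sig i i) 0.
  by rewrite eps_eq0// S0 !(mulr0, mul0r, expr0n)/= subr0 mul0r.
have sdp : 0 < sd i by rewrite sqrtr_gt0 lt_def S0 gram_diag_ge0.
rewrite /threshold_fun.
have -> : (t < `|eps i z / sd i|) = (sigma * sd i * t < `|sigma * eps i z|).
  rewrite !normrM (gtr0_norm sigma0) normfV (gtr0_norm sdp) -mulrA ltr_pM2l//.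
  by rewrite ltr_pdivlMr// mulrC.
rewrite exprMn [in RHS]exprMn exprVn sd_sqr 2!mulrA; congr (_ * _).
rewrite -[RHS]mulrA mulrBr [Sig i i * (_ / _)]mulrCA divff// mulr1; ring.
Qed.

(** The error of coordinate [i] of the support once the linear term [2 sigma theta i eps i] is
    removed. *)
Definition remainder i z : R := if theta i == 0 then 0 else
  (Yobs theta sigma A z i ^+ 2 - sigma ^+ 2 * Sig i i * b)
    * (if sigma * sd i * t < `|Yobs theta sigma A z i| then 1 else 0)
  - theta i ^+ 2 - 2 * sigma * (theta i * eps i z).

(** The bound is uniform in [theta i]. If the coordinate is kept, the remainder is
    [sigma^2 (eps^2 - Sig i i * b)]. If it is killed, [- theta^2 - 2 sigma theta eps = sigma^2 eps^2
    - Y^2], and [Y^2 <= sigma^2 tau^2]. *)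
Lemma remainder_sqr_le i z :
  remainder i z ^+ 2 <= 3 * sigma ^+ 4 * (eps i z ^+ 4 + t ^+ 4 + b ^+ 2).
Proof.
have /andP[b0 _] := beta_bounds tau_ge1.
have s2 := sqr_ge0 sigma; have S1 := Sig1 i; have S0 := gram_diag_ge0 A i.
have t2 := sqr_ge0 t; have e2 := sqr_ge0 (eps i z).
have key : `|remainder i z| <= sigma ^+ 2 * (eps i z ^+ 2 + t ^+ 2 + b).
  rewrite /remainder; case: ifP => _.
    by rewrite normr0 mulr_ge0// !addr_ge0.
  rewrite /Yobs -/(eps i z); set e := eps i z in e2 *.
  case: ifPn => [_|].
    rewrite mulr1.
    have -> : (theta i + sigma * e) ^+ 2 - sigma ^+ 2 * Sig i i * b - theta i ^+ 2 - 2 * sigma * (theta i * e)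
       = sigma ^+ 2 * (e ^+ 2 - Sig i i * b) by ring.
    rewrite normrM (ger0_norm s2); apply: ler_wpM2l => //.
    have : Sig i i * b <= b by rewrite ler_piMl.
    have : 0 <= Sig i i * b by rewrite mulr_ge0.
    rewrite ler_norml => h1 h2; apply/andP; split; lra.
  rewrite -leNgt => hY; rewrite mulr0.
  have -> : 0 - theta i ^+ 2 - 2 * sigma * (theta i * e) = sigma ^+ 2 * e ^+ 2 - (theta i + sigma * e) ^+ 2 by ring.
  have Y2 : (theta i + sigma * e) ^+ 2 <= sigma ^+ 2 * t ^+ 2.
    rewrite -[leLHS]real_normK ?num_real//.
    apply: (@le_trans _ _ ((sigma * sd i * t) ^+ 2)).
      have t0 := le_trans ler01 tau_ge1.
      apply: lerXn2r => //; rewrite nnegrE ?normr_ge0//.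
      by rewrite !mulr_ge0// ?sqrtr_ge0// ltW.
    by rewrite !exprMn sd_sqr mulrAC; apply: ler_piMr => //; rewrite mulr_ge0.
  have Y0 := sqr_ge0 (theta i + sigma * e).
  have b1 := mulr_ge0 s2 b0; have e1 := mulr_ge0 s2 e2; have t1 := mulr_ge0 s2 t2.
  rewrite ler_norml; apply/andP; split; lra.
rewrite -[leLHS]real_normK ?num_real//.
apply: (@le_trans _ _ ((sigma ^+ 2 * (eps i z ^+ 2 + t ^+ 2 + b)) ^+ 2)).
  by apply: lerXn2r => //; rewrite nnegrE// mulr_ge0// !addr_ge0.
rewrite exprMn -exprM -[leRHS]mulrA [leRHS]mulrCA.
apply: ler_wpM2l; first by rewrite exprn_even_ge0.
rewrite (exprM (eps i z) 2 2) (exprM t 2 2).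
move: (eps i z ^+ 2) (t ^+ 2) (b) => x y u.
have := sqr_ge0 (x - y); have := sqr_ge0 (x - u); have := sqr_ge0 (y - u); lra.
Qed.

Lemma sparse_devE z : dev z = 2 * sigma * (\sum_i theta i * eps i z)
  + \sum_i remainder i z
  + sigma ^+ 2 * \sum_i stat_term A (threshold_fun t b)
      (fun i => if theta i == 0 then Sig i i else 0) i z.
Proof.
rewrite /Qhat sF /sqnorm -sumrB !mulr_sumr -!big_split/=; apply: eq_bigr => i _.
rewrite /remainder /stat_term/=; have [thi|thi] := eqVneq (theta i) 0.
  by rewrite (threshold_termE z thi) thi; ring.
rewrite mul0r; move: (_ * (if _ then 1 else 0)) => q; ring.
Qed.

Lemma remainder_sum_sqr_le z : (\sum_i remainder i z) ^+ 2 <=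
  \sum_i (if theta i == 0 then 0 else 3 * sigma ^+ 4 * s%:R) * eps i z ^+ 4
  + 3 * sigma ^+ 4 * s%:R ^+ 2 * (t ^+ 4 + b ^+ 2).
Proof.
have sR' := sR.
have s4 : 0 <= sigma ^+ 4 by rewrite exprn_even_ge0.
have t4 : 0 <= t ^+ 4 by rewrite exprn_even_ge0.
pose S := theta_supp theta.
have E : \sum_i remainder i z = \sum_(i in S) remainder i z * 1.
  rewrite [RHS]big_mkcond; apply: eq_bigr => i _; rewrite inE mulr1 /remainder.
  by case: eqP.
have cardS : \sum_(i in S) (1 : R) ^+ 2 <= s%:R.
  by under eq_bigr do rewrite expr1n; rewrite sumr_const ler_nat.
have cardS0 : 0 <= \sum_(i in S) (1 : R) ^+ 2 by apply: sumr_ge0 => i _; exact: sqr_ge0.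
rewrite E; apply: (le_trans (sqr_sum_le _ _ _)).
apply: (@le_trans _ _ ((\sum_(i in S) 3 * sigma ^+ 4 * (eps i z ^+ 4 + t ^+ 4 + b ^+ 2)) * s%:R)).
  apply: ler_pM => //; first by apply: sumr_ge0 => i _; exact: sqr_ge0.
  by apply: ler_sum => i _; exact: remainder_sqr_le.
have -> : (\sum_(i in S) 3 * sigma ^+ 4 * (eps i z ^+ 4 + t ^+ 4 + b ^+ 2)) * s%:R =
  \sum_(i in S) (3 * sigma ^+ 4 * s%:R * eps i z ^+ 4) + 
  3 * sigma ^+ 4 * s%:R * (t ^+ 4 + b ^+ 2) * \sum_(i in S) (1 : R) ^+ 2.
  rewrite mulr_suml mulr_sumr -big_split; apply: eq_bigr => i _ /=; ring.
apply: lerD.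
  rewrite le_eqVlt; apply/orP; left; apply/eqP.
  rewrite big_mkcond; apply: eq_bigr => i _; rewrite inE.
  by case: eqP => //= _; rewrite mul0r.
have -> : 3 * sigma ^+ 4 * s%:R ^+ 2 * (t ^+ 4 + b ^+ 2) =
  3 * sigma ^+ 4 * s%:R * (t ^+ 4 + b ^+ 2) * s%:R by ring.
apply: ler_wpM2l => //.
apply: mulr_ge0; first by apply: mulr_ge0 => //; apply: mulr_ge0.
by apply: addr_ge0 => //; exact: sqr_ge0.
Qed.

Definition threshold_const : R := 260 ^+ 2 * (33 ^+ 2) ^+ 2.

(** The three terms account for the [tau^4 + beta^2] part of the remainder ([tau^4 = 81 L^2],
    [beta <= 64 tau^2 = 576 L]), its fourth moments, and the variance off the support; the factors 4
    come from [1 <= 4 L^2]. *)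
Definition sparse_const : R :=
  9 * (81 + 576 ^+ 2) + 4 * (128 * 9) + 4 * (3 * threshold_const).

(** Apply [expect_le_quadratic] with [g] the centred threshold function and weights that vanish on
    the support, where the remainder takes over. *)
Lemma sparse_risk (kap kap' : R) (f : (nat -> R) -> R) : 0 <= kap -> 0 <= kap' ->
  (forall z, 0 <= f z) -> (forall z, f z <= kap * dev z ^+ 2 + kap') ->
  (EE (fun z => (f z)%:E) <= (kap * (12 * (sigma ^+ 2 * signal_var A theta)
    + sparse_const * (sigma ^+ 4 * (s%:R * L) ^+ 2)) + kap')%:E)%E.
Proof.
move=> k0 k'0 f0 fle.
have t1 := tau_ge1; have t0 := le_trans ler01 t1.
have sR' := sR; have s2 := sqr_ge0 sigma.
have s4 : 0 <= sigma ^+ 4 by rewrite exprn_even_ge0.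
have t4 : 0 <= t ^+ 4 by rewrite exprn_even_ge0.
have M0 : (0 : R) <= 33 ^+ 2 by exact: sqr_ge0.
pose w i := if theta i == 0 then Sig i i else 0.
pose c i := if theta i == 0 then 0 else kap * (9 * sigma ^+ 4 * s%:R).
have w0 i : 0 <= w i <= Sig i i.
  by rewrite /w; case: ifP => _; rewrite ?lexx ?gram_diag_ge0.
have c_ge0 i : 0 <= c i.
  by rewrite /c; case: ifP => // _; apply: mulr_ge0 => //; apply: mulr_ge0 => //; apply: mulr_ge0.
have := @expect_le_quadratic R d A _ _ _ w (measurable_threshold_fun t b)
  (threshold_fun_even t) (threshold_fun_mean t1) M0 (threshold_fun_le t1) t0
  (@threshold_fun_supp _ t) w0
  f (fun j => \sum_i theta i * A i j) c (kap * (12 * sigma ^+ 2))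
  (kap * (9 * sigma ^+ 4 * s%:R ^+ 2 * (t ^+ 4 + b ^+ 2)) + kap') (kap * (3 * sigma ^+ 4)).
have c0 : 0 <= kap * (12 * sigma ^+ 2) by nonneg.
have c2 : 0 <= kap * (3 * sigma ^+ 4) by nonneg.
have k1 : 0 <= kap * (9 * sigma ^+ 4 * s%:R ^+ 2 * (t ^+ 4 + b ^+ 2)) + kap'.
  apply: addr_ge0 => //; apply: mulr_ge0 => //; apply: mulr_ge0.
    by apply: mulr_ge0; [apply: mulr_ge0|exact: sqr_ge0].
  by apply: addr_ge0 => //; exact: sqr_ge0.
move=> /(_ c0 k1 c2 c_ge0 Sig1 f0) h.
apply: (le_trans (h _)).
  move=> z; apply: (le_trans (fle z)); rewrite dot_signal sparse_devE -/w.
  have := remainder_sum_sqr_le z.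
  have -> : \sum_i c i * eps i z ^+ 4 = kap * (3 * \sum_i (if theta i == 0 then 0 else 3 * sigma ^+ 4 * s%:R) * eps i z ^+ 4).
    rewrite !mulr_sumr; apply: eq_bigr => i _; rewrite /c; case: ifP => _; ring.
  set a := \sum_i theta i * eps i z; set r := \sum_i remainder i z.
  set W := \sum_i stat_term _ _ _ i z; set q := \sum_i _ * _.
  move=> rle.
  have : (2 * sigma * a + r + sigma ^+ 2 * W) ^+ 2 <= 12 * sigma ^+ 2 * a ^+ 2 + 3 * r ^+ 2 + 3 * sigma ^+ 4 * W ^+ 2.
    have := sqr_ge0 (2 * sigma * a - r); have := sqr_ge0 (2 * sigma * a - sigma ^+ 2 * W).
    have := sqr_ge0 (r - sigma ^+ 2 * W); lra.
  move/(ler_wpM2l k0) => h1.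
  have h2 : kap * (3 * r ^+ 2) <= kap * (3 * (q + 3 * sigma ^+ 4 * s%:R ^+ 2 * (t ^+ 4 + b ^+ 2))).
    by apply: ler_wpM2l => //; apply: ler_wpM2l.
  lra.
rewrite lee_fin.
have l := log_ratio_ge.
have /andP[b0 b1] := beta_bounds t1.
have ssq : 0 <= sigma ^+ 4 * s%:R ^+ 2 by apply: mulr_ge0 => //; exact: sqr_ge0.
have L4 : 1 <= 4 * L ^+ 2 by nra.
have cs : \sum_i c i <= kap * (9 * sigma ^+ 4 * s%:R ^+ 2).
  have -> : \sum_i c i = \sum_(i in theta_supp theta) kap * (9 * sigma ^+ 4 * s%:R).
    rewrite [RHS]big_mkcond; apply: eq_bigr => i _; rewrite inE /c.
    by case: eqP.
  rewrite sumr_const -[leLHS]mulr_natr.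
  have -> : kap * (9 * sigma ^+ 4 * s%:R ^+ 2) = kap * (9 * sigma ^+ 4 * s%:R) * s%:R by ring.
  apply: ler_wpM2l; last by rewrite ler_nat.
  by apply: mulr_ge0 => //; apply: mulr_ge0 => //; apply: mulr_ge0.
have B1 : t ^+ 4 + b ^+ 2 <= (81 + 576 ^+ 2) * L ^+ 2.
  have -> : t ^+ 4 = 81 * L ^+ 2 by rewrite (exprM t 2 2) tau_sqr; ring.
  have : b ^+ 2 <= (576 * L) ^+ 2.
    apply: lerXn2r => //; rewrite ?nnegrE//; last by apply: (le_trans b1); rewrite tau_sqr; lra.
    by rewrite mulr_ge0//; lra.
  rewrite [X in _ <= X -> _]exprMn; move: (576 ^+ 2) => X; lra.
have B2 : cov_const (33 ^+ 2) t * \sum_i \sum_j Sig i j ^+ 2 <= threshold_const * s%:R ^+ 2.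
  rewrite -frob_sqr /cov_const -[leLHS]mulrA; apply: ler_wpM2l; last exact: tail_const_le.
  by rewrite mulr_ge0// sqr_ge0.
have D1 := ler_wpM2l (mulr_ge0 k0 ssq) B1.
have D2 := ler_wpM2l (mulr_ge0 k0 s4) B2.
have D3 := ler_wpM2l (mulr_ge0 k0 ssq) L4.
rewrite -/(signal_var A theta) /sparse_const.
have cc0 : 0 <= threshold_const by rewrite mulr_ge0 ?sqr_ge0.
have D4 := ler_wpM2l cc0 D3.
rewrite [(s%:R * L) ^+ 2]exprMn.
move: threshold_const (cov_const _ _) (\sum_i \sum_j _) B1 B2 D1 D2 D3 D4 {cc0}
  => cc cv G B1 B2 D1 D2 D3 D4.
move: (576 ^+ 2 : R) B1 D1 => c5 B1 D1.
lra.
Qed.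

End Sparse.
End RiskBound.


(** * Both regimes together, and the risk of [Nhat] *)

Section Risk.
Variables (R : realType) (d s : nat) (sigma : R) (A : 'M[R]_d) (theta : 'I_d -> R).
Local Notation EE := (@gauss_expect R d).
Local Notation Sig := (A *m A^T).
Local Notation dev z := (Qhat s sigma Sig (Yobs theta sigma A z) - sqnorm theta).
Hypotheses (s0 : (0 < s)%N) (sigma0 : 0 < sigma) (Sig1 : forall i, Sig i i <= 1)
  (th : in_B0 s theta).

Definition risk_const : R :=
  12 + (2 * (260 ^+ 2 * 16 ^+ 2) + sparse_const R).

Lemma risk_const_gt0 : 0 < risk_const.
Proof.
rewrite /risk_const /sparse_const ltr_pwDl//.
apply: addr_ge0; first by rewrite !mulr_ge0 ?sqr_ge0.
apply: addr_ge0; last by rewrite !mulr_ge0 ?sqr_ge0.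
apply: addr_ge0; last by rewrite !mulr_ge0.
by rewrite mulr_ge0// addr_ge0 ?sqr_ge0.
Qed.

Lemma quadratic_risk (kap kap' : R) (f : (nat -> R) -> R) : 0 <= kap -> 0 <= kap' ->
  (forall z, 0 <= f z) -> (forall z, f z <= kap * dev z ^+ 2 + kap') ->
  (EE (fun z => (f z)%:E) <= (kap * (risk_const * (sigma ^+ 2 * signal_var A theta
    + sigma ^+ 4 * psi s Sig ^+ 2)) + kap')%:E)%E.
Proof.
move=> k0 k'0 f0 fle.
have v0 : 0 <= sigma ^+ 2 * signal_var A theta by rewrite mulr_ge0 ?sqr_ge0 ?signal_var_ge0.
have p0 : 0 <= sigma ^+ 4 * psi s Sig ^+ 2 by rewrite mulr_ge0 ?sqr_ge0 ?exprn_even_ge0.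
have c1 : 0 <= 2 * (260 ^+ 2 * 16 ^+ 2) :> R by rewrite !mulr_ge0 ?sqr_ge0.
have c2 : 0 <= sparse_const R.
  apply: addr_ge0; last by rewrite !mulr_ge0 ?sqr_ge0.
  apply: addr_ge0; last by rewrite !mulr_ge0.
  by rewrite mulr_ge0// addr_ge0 ?sqr_ge0.
have [sF|Fs] := leP s%:R (frob Sig).
- apply: (le_trans (sparse_risk sigma0 Sig1 s0 sF th k0 k'0 f0 fle)).
  move: p0; rewrite lee_fin lerD2r /risk_const /psi sF => p0; apply: ler_wpM2l => //.
  move: (sparse_const R) (2 * _ : R) c1 c2 => x y y0 x0.
  have := mulr_ge0 x0 v0; have := mulr_ge0 y0 v0; have := mulr_ge0 y0 p0; lra.
- apply: (le_trans (dense_risk Sig1 k0 k'0 Fs f0 fle)).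
  move: p0; rewrite lee_fin lerD2r /risk_const /psi [s%:R <= _]leNgt Fs/= => p0; apply: ler_wpM2l => //.
  move: (sparse_const R) (2 * _ : R) c1 c2 => x y y0 x0.
  have := mulr_ge0 x0 v0; have := mulr_ge0 y0 v0; have := mulr_ge0 x0 p0; lra.
Qed.

Lemma risk_le_signal : (EE (fun z => (dev z ^+ 2)%:E) <=
  (risk_const * (sigma ^+ 2 * signal_var A theta + sigma ^+ 4 * psi s Sig ^+ 2))%:E)%E.
Proof.
have := @quadratic_risk 1 0 (fun z => dev z ^+ 2) ler01 (lexx 0).
rewrite mul1r addr0; apply => z; first exact: sqr_ge0.
by rewrite mul1r addr0.
Qed.

Lemma psi_ge0 : 0 <= psi s Sig.
Proof.
rewrite /psi; case: ifPn => [sF|_]; last exact: sqrtr_ge0.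
have l : 1 / 2 <= ln (1 + frob Sig ^+ 2 / s%:R ^+ 2) := log_ratio_ge s0 sF.
by rewrite mulr_ge0//; lra.
Qed.

(** The sparsity bound in the sparse regime, where [2 L >= 1], and the Frobenius bound in the dense
    one. *)
Lemma signal_var_le_psi : signal_var A theta <= 2 * psi s Sig * sqnorm theta.
Proof.
have b0 := sqnorm_ge0 theta.
rewrite /psi; case: ifPn => [sF|_].
  have l : 1 / 2 <= ln (1 + frob Sig ^+ 2 / s%:R ^+ 2) := log_ratio_ge s0 sF.
  apply: (le_trans (signal_var_le_sparsity Sig1 th)); apply: ler_wpM2r => //.
  by rewrite mulrCA ler_peMr//; lra.
apply: (le_trans (signal_var_le_frob A theta)); apply: ler_wpM2r => //.
by rewrite ler_peMl ?sqrtr_ge0//; lra.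
Qed.

(** With [x], [y] the two roots, [|x^2 - y^2| = |x - y| (x + y)], and [x + y] is at least both
    [|x - y|] and [y]. *)
Lemma sqrt_diff_le (q b : R) : 0 <= b ->
  (Num.sqrt `|q| - Num.sqrt b) ^+ 2 <= `|q - b| /\
  (Num.sqrt `|q| - Num.sqrt b) ^+ 2 * b <= (q - b) ^+ 2.
Proof.
move=> b0.
have x2 : Num.sqrt `|q| ^+ 2 = `|q| by rewrite sqr_sqrtr.
have y2 : Num.sqrt b ^+ 2 = b by rewrite sqr_sqrtr.
have x0 := sqrtr_ge0 `|q|; have y0 := sqrtr_ge0 b.
have qb : `| `|q| - b| <= `|q - b|.
  by have := lerB_dist q b; have := lerB_dist b q; rewrite (ger0_norm b0) distrC ler_norml => h1 h2; apply/andP; split; lra.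
move: (Num.sqrt `|q|) (Num.sqrt b) x2 y2 x0 y0 => x y x2 y2 x0 y0.
have E : `|q| - b = (x - y) * (x + y) by rewrite -x2 -y2; ring.
have Ea : `| `|q| - b| = `|x - y| * (x + y) by rewrite E normrM (ger0_norm (addr_ge0 x0 y0)).
have xy : `|x - y| <= x + y by rewrite ler_norml; apply/andP; split; lra.
have n0 := normr_ge0 (x - y).
have d2 : (x - y) ^+ 2 = `|x - y| ^+ 2 by rewrite real_normK ?num_real.
split.
  by apply: le_trans qb; rewrite Ea d2 expr2; apply: ler_wpM2l.
apply: (@le_trans _ _ (`| `|q| - b| ^+ 2)); last first.
  by rewrite -[leRHS]real_normK ?num_real//; apply: lerXn2r; rewrite ?nnegrE.
rewrite Ea exprMn -d2; apply: ler_wpM2l; first exact: sqr_ge0.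
by rewrite -y2; apply: lerXn2r; rewrite ?nnegrE ?addr_ge0//; lra.
Qed.

Lemma norm_risk : (EE (fun z => ((Nhat s sigma Sig (Yobs theta sigma A z)
      - Num.sqrt (sqnorm theta)) ^+ 2)%:E)
   <= ((3 * risk_const + 1) * (sigma ^+ 2 * psi s Sig))%:E)%E.
Proof.
have b0 := sqnorm_ge0 theta.
have C0 := ltW risk_const_gt0.
have s2 := sqr_ge0 sigma.
pose P := sigma ^+ 2 * psi s Sig.
have P0 : 0 <= P by rewrite mulr_ge0// psi_ge0.
have vle : sigma ^+ 2 * signal_var A theta + sigma ^+ 4 * psi s Sig ^+ 2 <= 2 * P * sqnorm theta + P ^+ 2.
  have := ler_wpM2l s2 signal_var_le_psi; rewrite /P; lra.
set b := sqnorm theta in b0 vle *.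
pose f z := (Nhat s sigma Sig (Yobs theta sigma A z) - Num.sqrt b) ^+ 2.
have f0 z : 0 <= f z by exact: sqr_ge0.
have vC := ler_wpM2l C0 vle.
have half (kap : R) : 0 < kap ->
    (EE (fun z => (f z)%:E) <= (kap * (risk_const * (2 * P * b + P ^+ 2)) + (4 * kap)^-1)%:E)%E.
  move=> k0.
  have k'0 : 0 <= (4 * kap)^-1 by rewrite invr_ge0 mulr_ge0// ltW.
  apply: le_trans (quadratic_risk (ltW k0) k'0 f0 _) _; last first.
    by rewrite lee_fin lerD2r; apply: ler_wpM2l => //; exact: ltW.
  move=> z; have [+ _] := sqrt_diff_le (Qhat s sigma Sig (Yobs theta sigma A z)) b0.
  rewrite -/(f z) -/b; move/le_trans; apply; set x := _ - b.
  have -> : x ^+ 2 = `|x| ^+ 2 by rewrite real_normK ?num_real.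
  (* Weighted AM-GM, [|x| <= kap x^2 + 1 / (4 kap)], brings a first-order error under the quadratic
     bound. *)
  have := sqr_ge0 (2 * kap * `|x| - 1) => h.
  rewrite -(@ler_pM2l _ (4 * kap)); last by rewrite mulr_gt0.
  rewrite mulrDr divff; last by rewrite mulf_neq0 ?lt0r_neq0.
  lra.
have [bP|Pb] := leP b P.
  have [P00|Pn] := eqVneq P 0.
    have bE : b = 0 by apply/le_anti; rewrite b0 -P00 bP.
    rewrite -/P P00 mulr0; apply/lee_addgt0Pr => e e0.
    (* When [P = b = 0] the quadratic part vanishes, and this [kap] makes the additive term equal to
       [e], an arbitrary positive number. *)
    have ep : 0 < (4 * e)^-1 by rewrite invr_gt0 mulr_gt0.
    apply: (le_trans (half _ ep)); rewrite -EFinD lee_fin P00 bE expr0n/= !mulr0 addr0 mulr0 mulr0 !add0r.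
    by rewrite le_eqVlt; apply/orP; left; apply/eqP; field; rewrite lt0r_neq0.
  have Pp : 0 < P by rewrite lt_def Pn.
  (* This [kap] balances the two parts: for [b <= P] both are of order [P]. *)
  have kp : 0 < (2 * P)^-1 by rewrite invr_gt0 mulr_gt0.
  apply: (le_trans (half _ kp)); rewrite lee_fin -/P.
  have -> : (2 * P)^-1 * (risk_const * (2 * P * b + P ^+ 2)) = risk_const * (b + P / 2) by field.
  have -> : (4 * (2 * P)^-1)^-1 = P / 2 by field.
  have : risk_const * (b + P / 2) <= risk_const * (3 * P) by apply: ler_wpM2l => //; lra.
  lra.
have bp : 0 < b by apply: le_lt_trans Pb.
have ib : 0 <= b^-1 by rewrite invr_ge0.
(* For [b > P] the second bound of [sqrt_diff_le] is used with [kap = 1 / b]; dividing by [b] tames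
   both [2 P b] and [P^2 <= P b]. *)
apply: le_trans (quadratic_risk ib (lexx 0) f0 _) _.
  move=> z; have [_ h] := sqrt_diff_le (Qhat s sigma Sig (Yobs theta sigma A z)) b0.
  by rewrite addr0 mulrC ler_pdivlMr.
rewrite lee_fin addr0 -/P mulrC ler_pdivrMr//; apply: (le_trans vC).
have : P * P <= P * b by apply: ler_wpM2l => //; exact: ltW.
move/(ler_wpM2l C0); have := mulr_ge0 P0 b0; lra.
Qed.

End Risk.

Theorem theorem1 (R : realType) :
  exists C : R, 0 < C /\
  forall (d s : nat) (sigma : R) (Sig A : 'M[R]_d),
    (1 <= d)%N -> (1 <= s <= d)%N -> 0 < sigma ->
    covariance_mx Sig -> Sig = A *m A^T ->
    (forall i, Sig i i <= 1) ->
    [/\ (forall theta : 'I_d -> R, in_B0 s theta ->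
          (gauss_expect d (fun z =>
             ((Qhat s sigma Sig (Yobs theta sigma A z) - sqnorm theta) ^+ 2)%:E)
           <= (C * (sigma ^+ 2 * sqnorm theta
                      * lambda_max (principal_submx Sig (theta_supp theta))
                    + sigma ^+ 4 * psi s Sig ^+ 2))%:E)%E),
        (forall r : R, 0 < r -> forall theta : 'I_d -> R,
          in_B0 s theta -> in_B2 r theta ->
          (gauss_expect d (fun z =>
             ((Qhat s sigma Sig (Yobs theta sigma A z) - sqnorm theta) ^+ 2)%:E)
           <= (C * (sigma ^+ 2 * r ^+ 2 * psibar s Sig
                    + sigma ^+ 4 * psi s Sig ^+ 2))%:E)%E) &
        (forall theta : 'I_d -> R, in_B0 s theta ->
          (gauss_expect d (fun z =>
             ((Nhat s sigma Sig (Yobs theta sigma A z)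
               - Num.sqrt (sqnorm theta)) ^+ 2)%:E)
           <= (C * (sigma ^+ 2 * psi s Sig))%:E)%E)].
Proof.
(* The constant required by [norm_risk]; it dominates [risk_const], which suffices for [Qhat]. *)
exists (3 * risk_const R + 1); have C0 := risk_const_gt0 R.
split=> [|d s sigma Sig A d0 /andP[s0 _] sigma0 _ SigE Sig1]; first lra.
rewrite {}SigE in Sig1 *.
have s2 := sqr_ge0 sigma.
(* The two bounds for [Qhat] differ only in how [signal_var] is majorised. *)
have bound (theta : 'I_d -> R) (v : R) : in_B0 s theta -> signal_var A theta <= v ->
    (gauss_expect d (fun z => ((Qhat s sigma (A *m A^T) (Yobs theta sigma A z)
       - sqnorm theta) ^+ 2)%:E)
     <= ((3 * risk_const R + 1) * (sigma ^+ 2 * v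
          + sigma ^+ 4 * psi s (A *m A^T) ^+ 2))%:E)%E.
  move=> th Vv; apply: (le_trans (risk_le_signal s0 sigma0 Sig1 th)).
  rewrite lee_fin; apply: ler_pM; [exact: ltW| |lra|].
  - apply: addr_ge0; first by rewrite mulr_ge0// signal_var_ge0.
    by rewrite mulr_ge0 ?sqr_ge0// exprn_even_ge0.
  - by rewrite lerD2r ler_wpM2l.
split.
- move=> theta th; rewrite -[sigma ^+ 2 * sqnorm theta * _]mulrA.
  by apply: bound => //; exact: signal_var_le_lambda_supp.
- move=> r r0 theta th thr; rewrite -[sigma ^+ 2 * r ^+ 2 * _]mulrA; apply: bound => //.
  have b0 := sqnorm_ge0 theta.
  have br : sqnorm theta <= r ^+ 2.
    rewrite -[leLHS]sqr_sqrtr//; apply: lerXn2r => //; rewrite nnegrE ?sqrtr_ge0//.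
    exact: ltW.
  have Vm : signal_var A theta <= sqnorm theta * psibar s (A *m A^T).
    rewrite mulrC /psibar minElt; case: ifP => _; first exact: signal_var_le_lambda.
    exact: signal_var_le_sparsity.
  apply: (le_trans Vm); apply: ler_wpM2r => //.
  by rewrite le_min lambda_max_gram_ge0/=.
- by move=> theta th; exact: norm_risk.
Qed.
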